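(* Let $x$, $y$, $z$, $k$ be non-negative integers, $k\leq x,y,z$, and assume that $x$, $z$, and $k$ have parity opposite to the parity of $y$. Then \begin{align*} \operatorname{M}_{\odot}(B'_{x,y,z,k})={}&P\left(\tfrac{y+k+1}{2},\tfrac{z-k}{2},k\right) \prod_{i=1}^{(y-k-1)/2}\frac{\left(\frac{x-k}{2}+i\right)_k}{(i)_k} \\ &\times\prod_{i=1}^{(z-k)/2}\frac{\left(\frac{x+k}{2}+i\right)_{(y-k-1)/2}}{(k+i)_{(y-k-1)/2}} \frac{\left(\frac{x+k}{2}+i\right)_{(y+k+1)/2}}{(k+i)_{(y+k+1)/2}}. \end{align*}
   Context: $P(x,y,z)=\prod_{i=1}^x\prod_{j=1}^y\prod_{k=1}^z \frac{i+j+k-1}{i+j+k-2}$, and $(a)_k$ is the Pochhammer symbol (rising factorial). For $x,z$ of the same parity and $y$ of the opposite parity, the center of the hexagon $H_{x,y,z}$ (side-lengths $x,y,z,x,y,z$ in cyclic order on the triangular lattice) is the midpoint of a lattice segment $s$ parallel to the polar direction $2\pi/3$; $B'_{x,y,z,k}$ is obtained from $H_{x,y,z}$ by removing a ``disconnected bowtie'' consisting of two equilateral triangles of side-length $k$ placed so that $s$ joins their closest vertices (the triangles' edges not incident to those vertices being parallel to the sides of length $z$). $\operatorname{M}_{\odot}(R)$ denotes the number of centrally symmetric lozenge tilings of the region $R$. *)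

(* Defs.v *)
From mathcomp Require Import all_boot all_order all_algebra.

Set Implicit Arguments.
Unset Strict Implicit.
Unset Printing Implicit Defensive.

Import GRing.Theory.

(* The lattice point (u, v) stands for u + v * exp(i pi / 3) in the triangular
   lattice of the plane: raising u moves in polar direction 0, raising v in
   polar direction pi / 3, and (u, v) -> (u - 1, v + 1) in direction 2 pi / 3. *)
Definition point := (nat * nat)%type.

(* The unit triangles of the lattice parallelogram with vertices (0, 0), (m, 0),
   (m, n), (0, n).  Each of its m * n unit rhombi, with lower left vertex
   (u, v), is cut by a segment of direction 2 pi / 3 into an upward-pointing
   triangle (u, v, true) and a downward-pointing triangle (u, v, false). *)
Definition cell (m n : nat) := ('I_m * 'I_n * bool)%type.

Definition corners (m n : nat) (c : cell m n) : seq point :=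
  let: (u, v, up) := c in
  [:: (u.+1, nat_of_ord v); (nat_of_ord u, v.+1);
      if up then (nat_of_ord u, nat_of_ord v) else (u.+1, v.+1)].

(* For a convex set of points Q, the unit triangles contained in it. *)
Definition cells_in (m n : nat) (Q : pred point) : {set cell m n} :=
  [set c | all Q (corners c)].

Definition share_edge (m n : nat) (c d : cell m n) : bool :=
  count [in corners d] (corners c) == 2.

Definition is_lozenge (m n : nat) (L : {set cell m n}) : bool :=
  [exists c : cell m n, exists d : cell m n,
     share_edge c d && (L == [set c; d])].

Definition is_tiling (m n : nat) (R : {set cell m n})
    (T : {set {set cell m n}}) : bool :=
  partition T R && [forall L in T, is_lozenge L].

(* Rotation by 180 degrees about the center (m / 2, n / 2) of the
   parallelogram. *)
Definition half_turn (m n : nat) (c : cell m n) : cell m n :=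
  let: (u, v, up) := c in (rev_ord u, rev_ord v, ~~ up).

Definition centrally_symmetric (m n : nat) (T : {set {set cell m n}}) : bool :=
  [set @half_turn m n @: L | L : {set cell m n} in T] == T.

(* The number of centrally symmetric lozenge tilings of R, for a region R whose
   center of symmetry is the center of the ambient parallelogram. *)
Definition M_odot (m n : nat) (R : {set cell m n}) : nat :=
  #|[set T : {set {set cell m n}} | is_tiling R T && centrally_symmetric T]|.

(* The hexagon with side-lengths x, y, z, x, y, z clockwise from the top, where
   the sides of length x, y, z have polar directions 0, 2 pi / 3, pi / 3.
   Its vertices are (y, 0), (x + y, 0), (x + y, z), (x, y + z), (0, y + z) and
   (0, y), and its center is that of the parallelogram. *)
Definition hexagon (x y z : nat) : {set cell (x + y) (y + z)} :=
  cells_in (x + y) (y + z) (fun p =>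
    [&& p.1 <= x + y, p.2 <= y + z & y <= p.1 + p.2 <= x + y + z]).

(* When x + y and y + z are odd, with a = (x + y - 1) / 2 and
   b = (y + z - 1) / 2, the center ((x + y) / 2, (y + z) / 2) of the hexagon is
   the midpoint of the lattice segment s, of direction 2 pi / 3, from
   (a + 1, b) to (a, b + 1).
   The two removed triangles have vertices
     (a, b + 1), (a - k, b + 1), (a - k, b + 1 + k)   and
     (a + 1, b), (a + 1 + k, b), (a + 1 + k, b - k);
   in each of them the edge not incident to the first vertex is parallel to
   the sides of length z. *)
Definition upper_triangle (x y z k : nat) : {set cell (x + y) (y + z)} :=
  let a := (x + y)./2 in
  let b := (y + z)./2 in
  cells_in (x + y) (y + z) (fun p =>
    [&& a <= p.1 + k, b.+1 <= p.2 & p.1 + p.2 <= a + b.+1]).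

Definition lower_triangle (x y z k : nat) : {set cell (x + y) (y + z)} :=
  let a := (x + y)./2 in
  let b := (y + z)./2 in
  cells_in (x + y) (y + z) (fun p =>
    [&& p.1 <= a.+1 + k, p.2 <= b & a.+1 + b <= p.1 + p.2]).

Definition B' (x y z k : nat) : {set cell (x + y) (y + z)} :=
  hexagon x y z :\: (upper_triangle x y z k :|: lower_triangle x y z k).

Local Open Scope ring_scope.

Definition P (x y z : nat) : rat :=
  \prod_(1 <= i < x.+1) \prod_(1 <= j < y.+1) \prod_(1 <= k < z.+1)
    ((i + j + k - 1)%N%:R / (i + j + k - 2)%N%:R).

Definition pochhammer (a : rat) (k : nat) : rat := \prod_(i < k) (a + i%:R).

(* Main.v *)
(* The line through s cuts a centrally symmetric tiling into two congruent
   halves, and the tiles straddling it leave uncovered on it the positions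
   (measured from s) 0, 1, ..., k and +-alpha for alpha in an n-element set A of
   integers above k, where n = (y - k - 1) / 2.  The removed triangles play no
   further role: the half tiling is a family of y nonintersecting paths, none
   of which can enter a triangle it has to avoid at the end.  Hence the half
   tilings are counted by a determinant of binomial coefficients, which is a
   product of factorials times a Vandermonde determinant.  Pairing alpha with
   -alpha turns the sum over A into a discrete Selberg sum
     sum_A prod_(alpha in A) w(alpha) prod_(alpha < beta) (alpha^2 - beta^2)^2,
   where w is a weight of Racah polynomials.  By Andreief's identity it is the
   determinant of moments of w, all of which are products of factorials. *)
Require Import Defs.
From mathcomp Require Import all_boot all_order all_algebra.
From mathcomp Require Import perm zify ring lra.

Set Implicit Arguments.
Unset Strict Implicit.
Unset Printing Implicit Defensive.

Import Order.TTheory GRing.Theory Num.Theory.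

(** * Tilings of abstract regions *)

Section Tilings.
Variables (C : finType) (e : rel C).

(** Signs are the obstacle: end points are listed by functions, in no particular order, so every
    count is the absolute value of a determinant. This is compatible with removing one row of
    triangles at a time: Pascal's rule splits each row of the binomial matrix just as a triangle has
    two possible lower partners, and positions that move by 0 or 1 without colliding keep their
    order, so all surviving terms have the sign of the Vandermonde product. Both determinant
    evaluations rest on one device. Once row factors are removed, the entries are polynomials of
    degree below the size in one variable per row; the determinant is then proportional to a
    Vandermonde product, and the constant is read off at points where the matrix is triangular. The
    moments are not taken in powers of [alpha ^ 2]. Rows use the products of [(a - t)^2 - alpha^2],
    columns the same with [b]; these factors cancel factorials of the weight and merely lower [a]
    and [b], so each entry is a total mass, evaluated by a recurrence. The entries then split into a
    row part, a column part and a function of [i + j]. *)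

Definition tiling (R : {set C}) (T : {set {set C}}) : bool :=
  partition T R &&
  [forall L in T, [exists c, exists d, e c d && (L == [set c; d])]].

Definition tilings (R : {set C}) : nat := #|[set T | tiling R T]|.

Lemma tilingP (R : {set C}) (T : {set {set C}}) : reflect
  [/\ forall L, L \in T -> exists c d, e c d /\ L = [set c; d],
      forall L, L \in T -> L \subset R,
      forall c, c \in R -> exists2 L, L \in T & c \in L
    & forall L L' c, L \in T -> L' \in T -> c \in L -> c \in L' -> L = L']
  (tiling R T).
Proof.
apply: (iffP andP) => [[partT /forall_inP lozT] | [lozT sT cT uT]].
  have [/eqP covT /trivIsetP trT _] := and3P partT.
  split=> [L /lozT /existsP[c /existsP[d /andP[ecd /eqP->]]]|L LT|c|L L' c LT L'T cL cL'].
  - by exists c, d.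
  - exact: partitionS partT LT.
  - by rewrite -covT => /bigcupP[L LT cL]; exists L.
  - apply/eqP/negPn/negP => /(trT L L' LT L'T).
    by rewrite disjoints_subset => /subsetP/(_ _ cL); rewrite inE cL'.
split; last first.
  apply/forall_inP => L /lozT[c [d [ecd ->]]].
  by apply/existsP; exists c; apply/existsP; exists d; rewrite ecd eqxx.
apply/and3P; split.
- rewrite eqEsubset; apply/andP; split; first by apply/bigcupsP => L /sT.
  by apply/subsetP => c /cT[L LT cL]; apply/bigcupP; exists L.
- apply/trivIsetP => L L' LT L'T; apply: contraR => /pred0Pn[c /andP[/= cL cL']].
  exact/eqP/(uT _ _ c).
- by apply/negP => /lozT[c [d [_ /setP/(_ c)]]]; rewrite !inE eqxx.
Qed.

Lemma tilingU (R1 R2 : {set C}) (T1 T2 : {set {set C}}) : [disjoint R1 & R2] ->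
  tiling R1 T1 -> tiling R2 T2 -> tiling (R1 :|: R2) (T1 :|: T2).
Proof.
move=> dis12 /tilingP[l1 s1 c1 u1] /tilingP[l2 s2 c2 u2].
have dis c L1 L2 : L1 \in T1 -> L2 \in T2 -> c \in L1 -> c \in L2 -> False.
  move=> /s1/subsetP s1' /s2/subsetP s2' /s1' cR1 /s2' cR2.
  by move: dis12; rewrite disjoints_subset => /subsetP/(_ _ cR1); rewrite inE cR2.
apply/tilingP; split=> [L|L|c|L L' c].
- by rewrite inE => /orP[/l1|/l2].
- rewrite inE => /orP[/s1|/s2] sL; apply: subset_trans sL _.
    exact: subsetUl.
  exact: subsetUr.
- rewrite inE => /orP[/c1|/c2] [L LT cL]; exists L => //; rewrite inE LT ?orbT //.
- rewrite !inE => /orP[LT|LT] /orP[LT'|LT'] cL cL'.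
  + exact: u1 cL cL'.
  + by case: (dis c L L').
  + by case: (dis c L' L).
  + exact: u2 cL cL'.
Qed.

Lemma tiling_cover (R : {set C}) (T : {set {set C}}) : tiling R T -> cover T = R.
Proof. by case/andP => /cover_partition. Qed.

Lemma tiling_sub (R : {set C}) (T X : {set {set C}}) : tiling R T -> X \subset T -> tiling (cover X) X.
Proof.
move=> /tilingP[lT sT cT uT] /subsetP XT; apply/tilingP; split=> [L|L LX|c|L L' c].
- by move/XT/lT.
- exact: bigcup_sup.
- by case/bigcupP => L; exists L.
- by move=> /XT LT /XT LT'; apply: uT.
Qed.

Lemma tilingD (R : {set C}) (T X : {set {set C}}) : tiling R T -> X \subset T ->
  tiling (R :\: cover X) (T :\: X).
Proof.
move=> tT XT; have := tT; case/tilingP => lT sT cT uT.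
apply/tilingP; split=> [L|L|c|L L' c].
- by rewrite inE => /andP[_ /lT].
- rewrite inE => /andP[LX LT]; apply/subsetP => c cL.
  rewrite inE (subsetP (sT _ LT)) // andbT; apply/negP => /bigcupP[L' L'X cL'].
  by move: LX; rewrite (uT _ _ c LT (subsetP XT _ L'X) cL cL') L'X.
- rewrite inE => /andP[cX /cT[L LT cL]]; exists L => //; rewrite inE LT andbT.
  by apply: contra cX => LX; apply/bigcupP; exists L.
- by rewrite !inE => /andP[_ LT] /andP[_ LT']; apply: uT.
Qed.

(** Adding [X] is injective on tilings of the rest because tiles are nonempty: none of those tiles
    can already belong to [X]. *)
Lemma tilings_extending (R Y : {set C}) (X : {set {set C}}) : tiling Y X -> Y \subset R ->
  #|[set T | tiling R T && (X \subset T)]| = tilings (R :\: Y).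
Proof.
move=> tX sYR; rewrite /tilings.
have covX := tiling_cover tX.
have disXT T : tiling (R :\: Y) T -> X :&: T = set0.
  move=> /tilingP[lT sT _ _]; apply/setP => L; rewrite !inE.
  apply/negP => /andP[LX LT]; have [c [d [_ eL]]] := lT _ LT.
  have cL : c \in L by rewrite eL !inE eqxx.
  have := subsetP (sT _ LT) _ cL; rewrite inE -covX => /andP[/bigcupP[]].
  by exists L.
rewrite -[RHS](card_in_imset (f := fun T => X :|: T)); last first.
  move=> T1 T2; rewrite !inE => /disXT d1 /disXT d2 /setP eT; apply/setP => L.
  have /setP/(_ L) := d1; have /setP/(_ L) := d2; move: (eT L); rewrite !inE.
  by case: (L \in X) => //= _ -> ->.
apply: eq_card => T; rewrite !inE; apply/andP/imsetP => [[tT XT]|[T' + ->]].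
  exists (T :\: X); first by rewrite inE -covX tilingD.
  by rewrite -[LHS](setID _ X) (setIidPr XT).
rewrite inE => tT'; split; last exact: subsetUl.
rewrite -(setID R Y) (setIidPr sYR); apply: tilingU => //.
by rewrite disjoint_sym disjoints_subset; apply/subsetP => c; rewrite !inE => /andP[].
Qed.

Hypotheses (e_sym : symmetric e) (e_irr : irreflexive e).

Lemma tilings0 : tilings set0 = 1.
Proof.
rewrite /tilings (_ : [set T | _] = [set set0]) ?cards1 //.
apply/setP => T; rewrite !inE /tiling partition_set0.
have [->|//] := eqVneq; by apply/forall_inP => L; rewrite inE.
Qed.

Lemma tilings_isolated (R : {set C}) c :
  c \in R -> (forall d, d \in R -> ~~ e c d) -> tilings R = 0.
Proof.
move=> cR iso; apply/eqP; rewrite cards_eq0; apply/eqP/setP => T; rewrite !inE.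
apply/negP => /tilingP[lT sT cT _]; have [L LT cL] := cT _ cR.
have [c1 [d1 [e1 eL]]] := lT _ LT.
have [c1R d1R] : c1 \in R /\ d1 \in R.
  by split; apply: (subsetP (sT _ LT)); rewrite eL !inE eqxx ?orbT.
move: cL; rewrite eL !inE => /orP[]/eqP ec; subst c.
  by move: (iso _ d1R); rewrite e1.
by move: (iso _ c1R); rewrite e_sym e1.
Qed.

(* The tiles covering the cells [s j] are indexed by the labels [eps j]: each
   tiling determines exactly one such labelling, so the tilings are counted by
   expanding [\prod_j \sum_b] into a sum over all labellings. *)
Lemma tilings_peel (J E : finType) (R : {set C}) (s : J -> C)
    (nb : J -> E -> C) (ok : J -> E -> bool) :
  injective s -> (forall j, s j \in R) -> (forall i j, ~~ e (s i) (s j)) ->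
  (forall j b, ok j b -> nb j b \in R /\ e (s j) (nb j b)) ->
  (forall j d, d \in R -> e (s j) d -> exists2 b, ok j b & nb j b = d) ->
  (forall j b b', ok j b -> ok j b' -> nb j b = nb j b' -> b = b') ->
  tilings R = \sum_(eps : {ffun J -> E} | [forall j, ok j (eps j)] &&
                    injectiveb (fun j => nb j (eps j)))
     tilings (R :\: ([set s j | j : J] :|: [set nb j (eps j) | j : J])).
Proof.
move=> s_inj sR s_ind nbR nb_ex nb_inj.
pose tile (j : J) b := [set s j; nb j b].
have one (T : {set {set C}}) : tiling R T ->
    \sum_(eps : {ffun J -> E}) \prod_j (ok j (eps j) && (tile j (eps j) \in T) : nat) = 1.
  move=> /tilingP[lT sT cT uT].
  rewrite -(bigA_distr_bigA (fun j b => (ok j b && (tile j b \in T) : nat))) big1 // => j _.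
  have [L LT sL] := cT _ (sR j).
  have [c [d [ecd eL]]] := lT _ LT.
  have [d' ed' eL'] : exists2 d', e (s j) d' & L = [set s j; d'].
    move: sL; rewrite eL !inE => /orP[/eqP->|/eqP->]; first by exists d.
    by exists c; rewrite 1?e_sym // setUC.
  have d'R : d' \in R by apply: (subsetP (sT _ LT)); rewrite eL' !inE eqxx orbT.
  have [b okb eb] := nb_ex _ _ d'R ed'.
  rewrite (bigD1 b) //= okb /tile eb -eL' LT big1 // => b' nb'.
  case okb': (ok j b') => //=; case: (boolP (_ \in T)) => // tT; case/eqP: nb'.
  have e' : [set s j; nb j b'] = L by apply: uT (s j) tT LT _ _; rewrite ?eL' !inE eqxx.
  apply: (nb_inj j) => //; rewrite eb.
  move/setP/(_ (nb j b')): e'; rewrite eL' !inE eqxx orbT.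
  case: eqP => [es|_ /esym/eqP //]; have [_] := nbR _ _ okb'.
  by rewrite es e_irr.
rewrite /tilings -sum1dep_card.
under eq_bigr => T tT do rewrite -(one T) //.
rewrite exchange_big /= [RHS]big_mkcond /=; apply: eq_bigr => eps _.
pose X := [set tile j (eps j) | j : J].
have prodE T : tiling R T -> \prod_j (ok j (eps j) && (tile j (eps j) \in T) : nat) =
    ([forall j, ok j (eps j)] && (X \subset T) : nat).
  move=> tT; case: (boolP [forall j, _]) => [/forallP oks|]; last first.
    by case/forallPn => j /negPf nok; rewrite (bigD1 j) //= nok.
  case: (boolP (X \subset T)) => [/subsetP XT|].
    by rewrite big1 // => j _; rewrite oks XT //; apply: imset_f.
  case/subsetPn => L /imsetP[j _ ->] /negPf nT.
  by rewrite (bigD1 j) //= oks nT.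
under eq_bigr => T tT do rewrite prodE //.
case: (boolP [forall j, _]) => [/forallP oks|_] /=; last by rewrite big1.
rewrite -big_mkcondr /= sum1dep_card; case: (boolP (injectiveb _)) => [/injectiveP nbi|ninj]; last first.
  apply/eqP; rewrite cards_eq0; apply/eqP/setP => T; rewrite !inE.
  apply/negP => /andP[/tilingP[_ _ _ uT] /subsetP XT]; case/injectiveP: ninj => i j eij.
  have tT h : tile h (eps h) \in T by apply: XT; apply: imset_f.
  have eT : tile i (eps i) = tile j (eps j).
    by apply: uT (nb j (eps j)) (tT i) (tT j) _ _; rewrite /tile !inE ?eij eqxx ?orbT.
  move/setP/(_ (s i)): eT; rewrite !inE eqxx /=.
  case: eqP => [/s_inj //|_ /esym/eqP es].
  by have [_] := nbR _ _ (oks j); rewrite -es (negPf (s_ind _ _)).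
apply: tilings_extending.
  apply/tilingP; split=> [L|L|c|L L' c].
  - by case/imsetP => j _ ->; exists (s j), (nb j (eps j)); case: (nbR _ _ (oks j)).
  - case/imsetP => j _ ->; apply/subsetP => c; rewrite !inE => /orP[/eqP->|/eqP->].
      by rewrite imset_f.
    by apply/orP; right; apply/imsetP; exists j.
  - rewrite inE => /orP[]/imsetP[j _ ->]; exists (tile j (eps j)); try exact: imset_f;
      by rewrite /tile !inE eqxx ?orbT.
  - case/imsetP => i _ -> /imsetP[j _ ->]; rewrite /tile !inE.
    have nsnb i' j' : s i' <> nb j' (eps j').
      by move=> es; have [_] := nbR _ _ (oks j'); rewrite -es (negPf (s_ind _ _)).
    case/orP => /eqP-> /orP[]/eqP; first by move/s_inj->.
    + by move/nsnb.
    + by move/esym/nsnb.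
    + by move/nbi->.
apply/subsetP => c; rewrite inE => /orP[]/imsetP[j _ ->] //.
by case: (nbR _ _ (oks j)).
Qed.

End Tilings.

(** * Tilings invariant under an involution exchanging two halves *)

Section SymmetricTilings.
Variables (C : finType) (e : rel C) (rho : C -> C) (low : {set C}).
Hypotheses (rhoK : involutive rho) (e_rho : forall c d, e (rho c) (rho d) = e c d).
Hypothesis low_rho : forall c, (rho c \in low) = (c \notin low).

Let rho_inj : injective rho := inv_inj rhoK.

Definition mirror (T : {set {set C}}) : {set {set C}} := [set rho @: L | L : {set C} in T].

Definition straddling (L : {set C}) : bool :=
  ~~ (L \subset low) && ~~ (L \subset ~: low).

Lemma rho_imsetK (L : {set C}) : rho @: (rho @: L) = L.
Proof. by rewrite -imset_comp (eq_imset (g := id)) ?imset_id. Qed.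

Lemma mirrorK : involutive mirror.
Proof.
move=> T; rewrite /mirror -imset_comp (eq_imset (g := id)) ?imset_id // => L.
exact: rho_imsetK.
Qed.

Lemma mem_mirror (L : {set C}) (T : {set {set C}}) : (L \in mirror T) = (rho @: L \in T).
Proof.
apply/imsetP/idP => [[L' L'T ->]|LT]; first by rewrite rho_imsetK.
by exists (rho @: L); rewrite ?rho_imsetK.
Qed.

Lemma rho_sub (L D : {set C}) : (rho @: L \subset D) = (L \subset rho @: D).
Proof.
by apply/idP/idP => /(imsetS rho); rewrite rho_imsetK.
Qed.

Lemma rho_low : rho @: low = ~: low.
Proof.
apply/setP => c; rewrite inE -low_rho -[in LHS](rhoK c) mem_imset //.
Qed.

Lemma tiling_mirror (R : {set C}) (T : {set {set C}}) :
  tiling e R T -> tiling e (rho @: R) (mirror T).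
Proof.
move=> /tilingP[lT sT cT uT]; apply/tilingP; split=> [L|L|c|L L' c].
- rewrite mem_mirror => /lT[c [d [ecd eL]]]; exists (rho c), (rho d).
  by rewrite e_rho -[L]rho_imsetK eL imsetU1 imset_set1.
- by rewrite mem_mirror => /sT; rewrite rho_sub.
- case/imsetP => d /cT[L LT dL] ->; exists (rho @: L); last exact: imset_f.
  by rewrite mem_mirror rho_imsetK.
- rewrite !mem_mirror => LT LT' cL cL'; apply: (imset_inj rho_inj).
  by apply: uT (rho c) LT LT' _ _; apply: imset_f.
Qed.

(* A symmetric tiling is determined by its straddling tiles and by its tiles
   in the lower half. *)
Lemma card_symmetric_tilings (R : {set C}) (X : {set {set C}}) :
  rho @: R = R -> tiling e (cover X) X -> cover X \subset R -> mirror X = X ->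
  {in X, forall L, straddling L} ->
  #|[set T | [&& tiling e R T, mirror T == T & [set L in T | straddling L] == X]]|
    = tilings e ((R :&: low) :\: cover X).
Proof.
move=> symR tX sXR symX strX.
set R0 := _ :\: _; pose glue T := X :|: (T :|: mirror T).
have nonempty (T R' L : _) : tiling e R' T -> L \in T -> exists c, c \in L.
  by move=> /tilingP[lT _ _ _] /lT[c [d [_ ->]]]; exists c; rewrite !inE eqxx.
have lowT T L : tiling e R0 T -> L \in T -> L \subset low.
  move=> /tilingP[_ sT _ _] /sT/subset_trans; apply.
  by apply/subsetP => c; rewrite !inE => /and3P[].
have not_both (L : {set C}) c : c \in L -> L \subset low -> L \subset ~: low -> False.
  by move=> cL /subsetP/(_ _ cL) cl /subsetP/(_ _ cL); rewrite inE cl.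
have highT T L : tiling e R0 T -> L \in mirror T -> L \subset ~: low.
  by move=> tT; rewrite mem_mirror => /(lowT _ _ tT); rewrite rho_sub rho_low.
have glueK T : tiling e R0 T -> [set L in glue T | L \subset low] = T.
  move=> tT; apply/setP => L; rewrite inE /glue !inE.
  case: (boolP (L \in T)) => LT; first by rewrite (lowT _ _ tT LT) orbT.
  rewrite orFb; case: (boolP (L \in X)) => [/strX/andP[/negPf->] //|_] /=.
  apply/negP => /andP[LT' Ll]; have [c cL] := nonempty _ _ _ (tiling_mirror tT) LT'.
  exact: not_both cL Ll (highT _ _ tT LT').
rewrite /tilings -[RHS](card_in_imset (f := glue)); last first.
  move=> T1 T2; rewrite !inE => /glueK {2}<- /glueK {2}<- -> //.
apply: eq_card => T; apply/idP/imsetP => [|[T0]]; rewrite !inE.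
  move=> /and3P[tT /eqP symT /eqP eX].
  have eT0 : glue [set L in T | L \subset low] = T.
    apply/setP => L; rewrite /glue -eX !inE mem_mirror inE.
    rewrite -mem_mirror symT rho_sub rho_low -!andb_orr /straddling.
    by case: (L \in T) => //=; case: (L \subset low); case: (L \subset ~: low).
  exists [set L in T | L \subset low] => //; rewrite inE.
  have sT0 : [set L in T | L \subset low] \subset T by apply/subsetP => L; rewrite inE => /andP[].
  rewrite (_ : R0 = cover [set L in T | L \subset low]); first exact: tiling_sub tT sT0.
  apply/setP => c.
  have [lT sT cT uT] := tilingP _ _ _ tT.
  rewrite !inE; apply/and3P/bigcupP => [[cX cR cl] | [L]]; last first.
    rewrite inE => /andP[LT Ll] cL; split; last exact: (subsetP Ll).
      apply/bigcupP => -[L' L'X cL']; have := L'X; rewrite -eX inE => /andP[L'T].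
      by rewrite -(uT _ _ _ LT L'T cL cL') /straddling Ll.
    exact: (subsetP (sT _ LT)).
  have [L LT cL] := cT _ cR; exists L => //; rewrite inE LT.
  apply: contraNT cX => nl; apply/bigcupP; exists L => //; rewrite -eX inE LT /straddling nl.
  by apply/negP => /subsetP/(_ _ cL); rewrite inE cl.
move=> tT0 ->; apply/and3P; split.
- have -> : R = cover X :|: (R0 :|: rho @: R0).
    have covX : rho @: cover X = cover X.
      rewrite -{2}symX; apply/setP => c; rewrite -{1}(rhoK c) mem_imset //.
      apply/bigcupP/bigcupP => -[L LX cL]; exists (rho @: L).
      + by rewrite mem_mirror rho_imsetK.
      + by rewrite -(rhoK c) imset_f.
      + by rewrite -mem_mirror.
      + exact: imset_f.
    apply/setP => c; rewrite /R0 !inE.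
    have -> : (c \in rho @: R0) = (rho c \in R0) by rewrite -{1}(rhoK c) mem_imset.
    have eX : (rho c \in cover X) = (c \in cover X) by rewrite -[in RHS]covX -{2}(rhoK c) mem_imset.
    have eR : (rho c \in R) = (c \in R) by rewrite -[in RHS]symR -{2}(rhoK c) mem_imset.
    rewrite /R0 !inE eX eR low_rho.
    case: (boolP (c \in cover X)) => [/(subsetP sXR)-> //|_] /=.
    by case: (c \in R); case: (c \in low).
  have R0l : R0 \subset low by apply/subsetP => c; rewrite !inE => /and3P[].
  have dl : [disjoint R0 & rho @: R0].
    rewrite disjoints_subset; apply: (subset_trans R0l).
    by rewrite subsetC -rho_low (imsetS rho R0l).
  apply: tilingU => //; last by apply: tilingU => //; apply: tiling_mirror.
  rewrite disjoints_subset; apply/subsetP => c cX; rewrite !inE cX /=.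
  rewrite -{1}(rhoK c) mem_imset // !inE.
  suff -> : rho c \in cover X by [].
  have /bigcupP[L LX cL] := cX; apply/bigcupP; exists (rho @: L); last exact: imset_f.
  by rewrite -mem_mirror symX.
- apply/eqP; rewrite {1}/mirror /glue !imsetU -!/(mirror _) symX mirrorK.
  by rewrite [mirror _ :|: _]setUC.
- apply/eqP/setP => L; rewrite /glue !inE.
  case: (boolP (L \in X)) => [/strX-> //|_] /=; apply/negP => /andP[/orP[]].
    by move=> /(lowT _ _ tT0) Ll; rewrite /straddling Ll.
  by move=> /(highT _ _ tT0) Ll; rewrite /straddling Ll andbF.
Qed.

End SymmetricTilings.

(** * The lattice and the region *)

(** The first rhombus carries the upward triangle, the second the downward one. The three cases
    correspond to the common edge being the diagonal, the left side or the bottom side of the upward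
    triangle. *)
Definition adjacent (u v u' v' : nat) : bool :=
  [|| (u == u') && (v == v'), (u == u'.+1) && (v == v') | (u == u') && (v == v'.+1)].

(** Abstracts the comparisons of two coordinates to mutually exclusive booleans, so that counting
    common corners becomes a finite truth table. *)
Lemma eqn_succ_cases (u v : nat) : exists A B C : bool,
  [/\ (u == v) = A, (v == u) = A, (u.+1 == v) = B, (v == u.+1) = B & (u == v.+1) = C]
  /\ (v.+1 == u) = C /\ [&& ~~ (A && B), ~~ (A && C) & ~~ (B && C)].
Proof.
exists (u == v), (u.+1 == v), (u == v.+1).
by split; first (split=> //; apply: eq_sym); split; [apply: eq_sym | lia].
Qed.

Lemma share_edgeE m n (c d : cell m n) :
  share_edge c d =
    (c.2 (+) d.2) && (if c.2 then adjacent c.1.1 c.1.2 d.1.1 d.1.2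
                      else adjacent d.1.1 d.1.2 c.1.1 c.1.2).
Proof.
case: c => [[[u hu] [v hv]] up]; case: d => [[[u' hu'] [v' hv']] up'].
rewrite /share_edge /corners /adjacent /=.
have [A [B [D [[e1 e2 e3 e4 e5] [e6]]]]] := eqn_succ_cases u u'.
have [A' [B' [D' [[e1' e2' e3' e4' e5'] [e6']]]]] := eqn_succ_cases v v'.
case: up; case: up'; rewrite /= !inE !xpair_eqE ?eqSS;
  rewrite ?e1 ?e2 ?e3 ?e4 ?e5 ?e6 ?e1' ?e2' ?e3' ?e4' ?e5' ?e6';
  by clear; case: A; case: B; case: D; case: A'; case: B'; case: D'.
Qed.

Lemma is_tilingE m n (R : {set cell m n}) T :
  is_tiling R T = tiling (@share_edge m n) R T.
Proof. by []. Qed.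

Lemma share_edge_sym m n : symmetric (@share_edge m n).
Proof.
move=> c d; rewrite !share_edgeE addbC.
by case: (c.2); case: (d.2).
Qed.

Lemma share_edge_irr m n : irreflexive (@share_edge m n).
Proof. by move=> c; rewrite share_edgeE addbb. Qed.

Lemma half_turnK m n : involutive (@half_turn m n).
Proof. by move=> [[u v] up]; rewrite /half_turn !rev_ordK negbK. Qed.

Lemma share_edge_half_turn m n (c d : cell m n) :
  share_edge (half_turn c) (half_turn d) = share_edge c d.
Proof.
case: c => [[[u hu] [v hv]] up]; case: d => [[[u' hu'] [v' hv']] up'].
rewrite !share_edgeE /= /adjacent.
by case: up; case: up' => //=; lia.
Qed.

(* [up_in] and [down_in] describe the unit triangles of [B'] lying over the
   rhombus with lower left vertex [(u, v)], where [a = (x + y - 1) / 2] and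
   [b = (y + z - 1) / 2]; the level [u + v] equals [a + b] on the rhombi whose
   diagonals lie on the line through the segment [s]. *)
Section Region.
Variables (y a b k : nat).

Definition up_in (u v : nat) : bool :=
  [&& u <= a.*2, v <= b.*2, y <= u + v, u + v + y <= (a + b).*2.+1,
      ~~ [&& a <= u + k, b < v & u + v <= a + b]
    & ~~ [&& u <= a + k, v < b & a + b < u + v]].

Definition down_in (u v : nat) : bool :=
  [&& u <= a.*2, v <= b.*2, y <= (u + v).+1, u + v + y <= (a + b).*2,
      ~~ [&& a <= u + k, b < v & u + v < a + b]
    & ~~ [&& u <= a + k, v < b & a + b <= u + v]].

Definition region m n : {set cell m n} :=
  [set c : cell m n | let: (u, v, up) := c in if up then up_in u v else down_in u v].

Lemma B'_region x z : x + y = a.*2.+1 -> y + z = b.*2.+1 ->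
  B' x y z k = region (x + y) (y + z).
Proof.
move=> hx hz; apply/setP => -[[[u hu] [v hv]] up].
rewrite /B' /hexagon /upper_triangle /lower_triangle /region !inE /=.
have -> : (x + y)./2 = a by lia.
have -> : (y + z)./2 = b by lia.
by rewrite /up_in /down_in; case: up => /=; rewrite !andbT; apply/idP/idP; lia.
Qed.

Lemma M_odot_B' x z : x + y = a.*2.+1 -> y + z = b.*2.+1 ->
  M_odot (B' x y z k) = M_odot (region a.*2.+1 b.*2.+1).
Proof. by move=> hx hz; rewrite B'_region // hx hz. Qed.

Local Notation C := (cell a.*2.+1 b.*2.+1).
Local Notation R := (region a.*2.+1 b.*2.+1).
Local Notation e := (@share_edge a.*2.+1 b.*2.+1).

Definition cell_at (u v : nat) (up : bool) : C := (inord u, inord v, up).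

Lemma cell_at_inj u v up u' v' up' : u <= a.*2 -> v <= b.*2 -> u' <= a.*2 -> v' <= b.*2 ->
  cell_at u v up = cell_at u' v' up' -> [/\ u = u', v = v' & up = up'].
Proof.
move=> hu hv hu' hv' [eu ev ->]; split=> //.
  by move/(congr1 val): eu; rewrite /= !inordK.
by move/(congr1 val): ev; rewrite /= !inordK.
Qed.

Lemma cell_atE (c : C) : c = cell_at c.1.1 c.1.2 c.2.
Proof. by case: c => [[u v] up]; rewrite /cell_at /= !inord_val. Qed.

Lemma share_edge_cell_at u v (d : C) : u <= a.*2 -> v <= b.*2 ->
  e (cell_at u v true) d = ~~ d.2 && adjacent u v d.1.1 d.1.2.
Proof. by move=> hu hv; rewrite share_edgeE /= !inordK. Qed.

Lemma share_edge_cell_at_down u v (d : C) : u <= a.*2 -> v <= b.*2 ->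
  e (cell_at u v false) d = d.2 && adjacent d.1.1 d.1.2 u v.
Proof. by move=> hu hv; rewrite share_edgeE /= !inordK. Qed.

Lemma cell_at_region u v up : u <= a.*2 -> v <= b.*2 ->
  (cell_at u v up \in R) = if up then up_in u v else down_in u v.
Proof. by move=> hu hv; rewrite inE /= !inordK. Qed.

(* The triangles of the region below level [t] with, at level [t], the upward
   ones over [S], respectively all the upward ones and the downward ones not
   over [S]. *)
Definition below_up (t : nat) (S : pred nat) : {set C} :=
  [set c in R | let: (u, v, up) := c in
     if up then (u + v < t) || (u + v == t) && S u else u + v < t].

Definition below_down (t : nat) (S : pred nat) : {set C} :=
  [set c in R | let: (u, v, up) := c in
     if up then u + v <= t else (u + v < t) || (u + v == t) && ~~ S u].

Definition occupied (r : nat) (s : 'I_r -> nat) : pred nat :=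
  fun u => [exists j, s j == u].

Lemma occupiedP r (s : 'I_r -> nat) u : reflect (exists j, s j = u) (occupied s u).
Proof. by apply: (iffP existsP) => -[j /eqP]; exists j => //; apply/eqP. Qed.

(** The downward triangle of its own rhombus is absent, so an upward triangle of the top row must
    pair with one of the two downward triangles a level lower. Its first coordinate then drops by
    [eps j], and injectivity says that no two triangles claim the same partner. *)
Lemma tilings_below_up r t (s : 'I_r -> nat) :
  y <= t.+1 -> t < a + b -> injective s ->
  (forall j, s j <= t.+1 /\ up_in (s j) (t.+1 - s j)) ->
  tilings e (below_up t.+1 (occupied s)) =
    \sum_(eps : {ffun 'I_r -> bool} |
         [forall j, if eps j then 0 < s j else s j <= t] &&
         injectiveb (fun j => s j - eps j))
      tilings e (below_down t (occupied (fun j => s j - eps j))).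
Proof.
move=> yt tab s_inj s_in.
pose ups j := cell_at (s j) (t.+1 - s j) true.
pose nb j (b : bool) := cell_at (s j - b) (t - (s j - b)) false.
pose ok (j : 'I_r) (b : bool) := if b then 0 < s j else s j <= t.
have bnd j : s j <= a.*2 /\ t.+1 - s j <= b.*2.
  by have [_ /and3P[]] := s_in j.
have bnd' j c : ok j c -> s j - c <= a.*2 /\ t - (s j - c) <= b.*2.
  by have := bnd j; rewrite /ok; case: c; lia.
rewrite (@tilings_peel _ e (@share_edge_sym _ _) (@share_edge_irr _ _) _ _ _ ups nb ok) /=.
- apply: eq_big => [eps|eps /andP[/forallP oks /injectiveP nbi]].
    apply: andb_id2l => /forallP oks; apply/injectiveP/injectiveP => inj i j eij.
      apply: inj; rewrite /nb; congr cell_at; lia.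
    have [h1 h2] := bnd' _ _ (oks i); have [h3 h4] := bnd' _ _ (oks j).
    by apply: inj; case: (cell_at_inj h1 h2 h3 h4 eij).
  have e1 (u : 'I_a.*2.+1) (v : 'I_b.*2.+1) up :
      ((u, v, up) \in [set ups j | j : 'I_r]) = [&& up, u + v == t.+1 & occupied s u].
    apply/imsetP/and3P => [[j _ [-> -> ->]]|[upT /eqP uv /occupiedP[j sj]]].
      have [h1 h2] := bnd j; have [h3 _] := s_in j; rewrite !inordK //.
      by split=> //; [lia | apply/occupiedP; exists j].
    exists j => //; rewrite [LHS]cell_atE /ups /= upT; congr cell_at => //; lia.
  have e2 (u : 'I_a.*2.+1) (v : 'I_b.*2.+1) up :
      ((u, v, up) \in [set nb j (eps j) | j : 'I_r]) =
      [&& ~~ up, u + v == t & occupied (fun j => s j - eps j) u].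
    apply/imsetP/and3P => [[j _ [-> -> ->]]|[upT /eqP uv /occupiedP[j sj]]].
      have [h1 h2] := bnd' _ _ (oks j); have [h3 _] := s_in j; rewrite !inordK //.
      have h4 : s j - eps j <= t by have := oks j; rewrite /ok; case: (eps j) => /=; lia.
      by split=> //; [lia | apply/occupiedP; exists j].
    exists j => //; rewrite [LHS]cell_atE /nb /= (negPf upT); congr cell_at => //; lia.
  congr (tilings e _); apply/setP => -[[u v] up]; rewrite in_setD in_setU e1 e2 !inE.
  case: up => /=; rewrite ?orbF ?orFb.
    by case: (up_in u v); rewrite ?andbF //=; case: (occupied s u); lia.
  by case: (down_in u v); rewrite ?andbF //=; case: (occupied _ u); lia.
- move=> i j eij; apply: s_inj.
  have [h1 h2] := bnd i; have [h3 h4] := bnd j.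
  by case: (cell_at_inj h1 h2 h3 h4 eij).
- move=> j; have [h1 h2] := bnd j; have [h3 h4] := s_in j.
  rewrite inE cell_at_region // h4 /= !inordK //; apply/orP; right.
  by apply/andP; split; [lia | apply/occupiedP; exists j].
- move=> i j; have [h1 h2] := bnd i; have [h3 h4] := bnd j.
  by rewrite share_edgeE.
- move=> j c okj; have [h1 h2] := bnd j; have [h3 h4] := bnd' _ _ okj.
  have [h5 h6] := s_in j; split.
    rewrite inE cell_at_region //= !inordK //; move: h6 okj; rewrite /up_in /down_in /ok.
    by case: c {h3 h4} => /=; lia.
  rewrite share_edge_cell_at //= !inordK // /adjacent; move: okj; rewrite /ok.
  by case: c {h3 h4} => /=; lia.
- move=> j [[u v] up]; have [h1 h2] := bnd j; have [h5 h6] := s_in j.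
  rewrite share_edge_cell_at //= inE => /andP[dR lev] /andP[/negPf upF]; rewrite upF in dR lev *.
  rewrite /adjacent /= => adj.
  exists (u != s j :> nat); rewrite /ok /nb.
    by case: eqP => /= ?; lia.
  rewrite [RHS]cell_atE /=; congr cell_at; by case: eqP => /= ?; lia.
- move=> j c c' okc okc'; have [h3 h4] := bnd' _ _ okc; have [h5 h6] := bnd' _ _ okc'.
  case/(cell_at_inj h3 h4 h5 h6); move: okc okc'; rewrite /ok.
  by case: c {h3 h4}; case: c' {h5 h6}; lia.
Qed.

(** A downward triangle of the top row has lost both neighbours of the next level, so it is forced
    onto the upward triangle of its own rhombus. With labels in [unit], peeling leaves a single
    term. *)
Lemma tilings_below_down t (S : pred nat) : y <= t -> t < a + b ->
  tilings e (below_down t S) = tilings e (below_up t S).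
Proof.
move=> yt tab.
pose J := {c : C | (c \in R) && (let: (u, v, up) := c in [&& ~~ up, u + v == t & ~~ S u])}.
pose nb (j : J) (_ : unit) : C := ((val j).1, true).
have level (j : J) : [/\ ((val j).1.1 + (val j).1.2)%N = t, (val j).2 = false,
    ~~ S (val j).1.1 & down_in (val j).1.1 (val j).1.2].
  case: j => [[[u v] up] /= /andP[]]; rewrite inE.
  by case: up => //= h /andP[/eqP h1 h2].
rewrite (@tilings_peel _ e (@share_edge_sym _ _) (@share_edge_irr _ _) _ _ _ val nb (fun _ _ => true)) /=.
- rewrite (big_pred1 [ffun=> tt]) => [|eps]; last first.
    have -> : eps = [ffun=> tt] by apply/ffunP => j; case: (eps j); rewrite ffunE.
    rewrite /= eqxx; apply/andP; split; first by apply/forallP.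
    apply/injectiveP => i j [eij]; apply/val_inj.
    have [_ ui _ _] := level i; have [_ uj _ _] := level j.
    by rewrite (surjective_pairing (val i)) (surjective_pairing (val j)) eij ui uj.
  congr (tilings e _); apply/setP => c; rewrite in_setD in_setU.
  have -> : (c \in [set val j | j : J]) =
      (c \in R) && (let: (u, v, up) := c in [&& ~~ up, u + v == t & ~~ S u]).
    by apply/imsetP/idP => [[j _ ->]|h]; [apply: (valP j) | exists (Sub c h)].
  have -> : (c \in [set nb j ([ffun=> tt] j) | j : J]) =
      ((c.1, false) \in R) && (let: (u, v, up) := c in [&& up, u + v == t & ~~ S u]).
    apply/imsetP/idP => [[j _ ->]|]; rewrite /nb /=.
      have := level j; case: j => -[[u v] up] /= h [h1 h2 h3 _].
      by move: h; rewrite h1 h2 h3 eqxx !andbT.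
    case: c => [[u v] up] /and4P[h1 -> h2 h3].
    have h : (((u, v, false) : C) \in R) && [&& ~~ false, u + v == t & ~~ S u].
      by rewrite h1 h2 h3.
    by exists (Sub ((u, v, false) : C) h).
  case: c => [[u v] up]; rewrite !inE /=.
  case: up => /=; rewrite ?andbF ?andbT ?orbF ?orFb /=.
    have : (u + v == t) ==> (down_in u v ==> up_in u v) by rewrite /up_in /down_in; lia.
    have : (u + v == t) ==> (up_in u v ==> down_in u v) by rewrite /up_in /down_in; lia.
    case: (up_in u v); case: (down_in u v); rewrite ?andbF //=; case: (S u); lia.
  by case: (down_in u v); rewrite ?andbF //=; case: (S u); lia.
- exact: val_inj.
- move=> j; have := level j; case: j => -[[u v] up] /= h [h1 h2 h3 h4].
  by rewrite !inE h2 h1 h3 h4 eqxx orbT.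
- by move=> i j; rewrite share_edgeE; have [_ -> _ _] := level i; have [_ -> _ _] := level j.
- move=> j [] _; split; last first.
    by rewrite share_edgeE /nb /=; have [_ -> _ _] := level j; rewrite /adjacent !eqxx.
  have := level j; rewrite !inE /nb; case: j => -[[u v] up] /= h [h1 h2 h3 h4].
  by move: h4; rewrite /up_in /down_in; lia.
- move=> j [[u v] up]; have [h1 h2 h3 h4] := level j.
  rewrite share_edgeE h2 !inE /nb; case: j h1 h2 h3 h4 => -[[u' v'] up'] h /= h1 h2 h3 h4.
  case: up => //= /andP[h5 h6]; rewrite /adjacent => adj.
  exists tt => //; congr (_, _, _); apply/val_inj => /=; lia.
- by move=> j [] [].
Qed.

(** Below the axis the removed triangle is cut out by the lower bounds [a <= u + k] and [b < v]. A
    step down lowers one coordinate, so whichever bound fails keeps failing. *)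
Lemma down_in_step t u (c : bool) : y <= t.+1 -> t < a + b ->
  u <= t.+1 -> up_in u (t.+1 - u) -> (if c then 0 < u else u <= t) ->
  u - c <= t /\ down_in (u - c) (t - (u - c)).
Proof. by move=> h1 h2 h3 h4; rewrite /up_in in h4; case: c => /= h5; split; rewrite /down_in; lia. Qed.

End Region.

(** * Cutting along the axis through the center *)

Section Halving.
Variables (y a b k : nat).
Hypotheses (y_gt0 : 0 < y) (y_le : y <= a + b) (k_le_a : k <= a) (k_le_b : k <= b).

Local Notation C := (cell a.*2.+1 b.*2.+1).
Local Notation R := (region y a b k a.*2.+1 b.*2.+1).
Local Notation e := (@share_edge a.*2.+1 b.*2.+1).
Local Notation rho := (@half_turn a.*2.+1 b.*2.+1).
Local Notation h := (minn a b - k).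
Local Notation up_in := (up_in y a b k).
Local Notation down_in := (down_in y a b k).

(** Vertices on the axis have coordinate sum [a + b + 1]; hence in a rhombus of level [a + b] the
    upward triangle lies below the axis and the downward one above it. *)
Definition low : {set C} := [set c : C | let: (u, v, up) := c in
  if up then u + v <= a + b else u + v < a + b].

Definition diag (u : nat) : {set C} :=
  [set cell_at a b u (a + b - u) true; cell_at a b u (a + b - u) false].

Lemma low_half_turn (c : C) : (rho c \in low) = (c \notin low).
Proof.
case: c => [[[u hu] [v hv]] up]; rewrite !inE /=.
by case: up => /=; lia.
Qed.

Lemma half_turn_cell_at u v up : u <= a.*2 -> v <= b.*2 ->
  rho (cell_at a b u v up) = cell_at a b (a.*2 - u) (b.*2 - v) (~~ up).
Proof.
move=> hu hv; rewrite /cell_at /half_turn; congr (_, _, _); apply/val_inj => /=.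
  by rewrite !inordK //; lia.
by rewrite !inordK //; lia.
Qed.

Lemma half_turn_region : rho @: R = R.
Proof.
apply/setP => c; rewrite -[in LHS](half_turnK c) mem_imset; last exact: inv_inj (@half_turnK _ _).
case: c => [[[u hu] [v hv]] up]; rewrite !inE /= /up_in /down_in.
by case: up => /=; apply/idP/idP; lia.
Qed.

(* Rhombi cut by the line through [s] are given by their first coordinate. *)
Definition on_axis (u : nat) : bool := [&& u <= a.*2, u <= a + b & a <= u + b].

Lemma diag_inj u u' : on_axis u -> on_axis u' -> diag u = diag u' -> u = u'.
Proof.
rewrite /on_axis => hu hu' /setP/(_ (cell_at a b u (a + b - u) true)).
rewrite !inE eqxx /= => /esym/orP[]/eqP; case/cell_at_inj => //; lia.
Qed.

Lemma half_turn_diag u : on_axis u -> rho @: diag u = diag (a.*2 - u).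
Proof.
rewrite /on_axis => hu; rewrite /diag imsetU1 imset_set1 !half_turn_cell_at; [|lia|lia|lia|lia].
by rewrite setUC; congr [set cell_at a b _ _ _; cell_at a b _ _ _]; lia.
Qed.

Lemma share_edge_diag u : on_axis u ->
  e (cell_at a b u (a + b - u) true) (cell_at a b u (a + b - u) false).
Proof.
rewrite /on_axis => hu; rewrite share_edge_cell_at; [|lia|lia].
by rewrite /= !inordK; [rewrite /adjacent !eqxx|lia|lia].
Qed.

Lemma low_cell_at u v up : u <= a.*2 -> v <= b.*2 ->
  (cell_at a b u v up \in low) = if up then u + v <= a + b else u + v < a + b.
Proof. by move=> hu hv; rewrite inE /= !inordK. Qed.

Lemma straddling_diag u : on_axis u -> straddling low (diag u).
Proof.
rewrite /on_axis /straddling => hu; apply/andP; split; apply/negP => /subsetP sub.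
  have := sub (cell_at a b u (a + b - u) false); rewrite !inE eqxx orbT => /(_ isT).
  by rewrite /= !inordK; lia.
have := sub (cell_at a b u (a + b - u) true); rewrite in_setC low_cell_at; [|lia|lia].
by rewrite !inE eqxx => /(_ isT); lia.
Qed.

Lemma straddlingP (L : {set C}) c d : e c d -> L = [set c; d] -> straddling low L ->
  exists2 u, on_axis u & L = diag u.
Proof.
wlog upc : c d / c.2.
  move=> hw ecd eL; case: (boolP c.2) => upc; first exact: hw ecd eL.
  apply: (hw d c); rewrite 1?share_edge_sym // 1?setUC //.
  by move: ecd; rewrite share_edgeE (negPf upc); case: (d.2).
move=> ecd ->; rewrite /straddling => /andP[nl nh].
have /andP[dd adj] : ~~ d.2 && adjacent c.1.1 c.1.2 d.1.1 d.1.2.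
  by move: ecd; rewrite share_edgeE upc; case: (d.2).
have cl : c \in low.
  apply: contraNT nh => nc; rewrite subUset !sub1set !in_setC nc /=.
  by move: nc adj dd upc; case: c {ecd nl} => -[u v] [] //; case: d => -[u' v'] [] //=;
    rewrite !inE /= /adjacent; lia.
have dl : d \notin low.
  by apply: contra nl => dl; rewrite subUset !sub1set cl.
move: cl dl adj dd upc; case: c {ecd nl nh} => -[u v] [] //; case: d => -[u' v'] [] //=.
rewrite !inE /= /adjacent => cl dl adj _ _.
have [hu hv] := (ltn_ord u, ltn_ord v).
exists (u : nat); first by rewrite /on_axis; lia.
rewrite /diag; congr [set _; _]; rewrite [LHS]cell_atE /=; congr cell_at; lia.
Qed.

(** At distance 1 to [k] from the center an axis rhombus has lost one half to a removed triangle: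
    the upward half on one side, the downward half on the other. *)
Lemma diag_region u : on_axis u -> (diag u \subset R) =
  ~~ [&& a <= u + k & u < a] && ~~ [&& u <= a + k & a < u].
Proof.
rewrite /on_axis => hu; rewrite /diag subUset !sub1set !cell_at_region; [|lia|lia|lia|lia].
by rewrite /up_in /down_in; apply/idP/idP; lia.
Qed.

(* Axis rhombi that are tiles: the ones at distance [k + 1 + j] from the
   center for [j] not in [A], and the central one unless [c]. *)
Definition axis_tile (A : {set 'I_h}) (c : bool) (u : nat) : bool :=
  (u == a) && ~~ c ||
  [exists j : 'I_h, (j \notin A) && ((u == a + k.+1 + j) || (u + k.+1 + j == a))].

Definition axis_tiles (A : {set 'I_h}) (c : bool) : {set {set C}} :=
  [set diag u | u : 'I_a.*2.+1 & axis_tile A c u].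

Lemma axis_tile_axis A c u : axis_tile A c u ->
  on_axis u && (diag u \subset R).
Proof.
have minE := geq_minl a b; have minE' := geq_minr a b.
rewrite /axis_tile /on_axis => hu; have hu' : on_axis u.
  case/orP: hu => [|/existsP[j]]; rewrite /on_axis; first lia.
  by have := ltn_ord j; lia.
rewrite diag_region // -/(on_axis u) hu' /=.
by case/orP: hu => [|/existsP[j]]; lia.
Qed.

Lemma axis_tile_sym A c u : u <= a.*2 -> axis_tile A c (a.*2 - u) = axis_tile A c u.
Proof.
move=> hu; rewrite /axis_tile; congr (_ || _); first by case: c; rewrite ?andbF ?andbT //; lia.
apply: eq_existsb => j; congr (_ && _); lia.
Qed.

Lemma axis_tilesP A c (L : {set C}) :
  reflect (exists2 u, axis_tile A c u & L = diag u) (L \in axis_tiles A c).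
Proof.
apply: (iffP imsetP) => [[u]|[u ut ->]]; first by rewrite inE => ut ->; exists u.
have /andP[/and3P[hu _ _] _] := axis_tile_axis ut.
have hu' : u < a.*2.+1 by [].
by exists (Ordinal hu'); rewrite ?inE.
Qed.

Lemma mem_axis_tiles A c u : on_axis u -> (diag u \in axis_tiles A c) = axis_tile A c u.
Proof.
move=> hu; apply/axis_tilesP/idP => [[u' ut /diag_inj]|ut]; last by exists u.
by have /andP[hu' _] := axis_tile_axis ut; move=> ->.
Qed.

Lemma mirror_axis_tiles A c : mirror rho (axis_tiles A c) = axis_tiles A c.
Proof.
have half L : L \in axis_tiles A c -> rho @: L \in axis_tiles A c.
  case/axis_tilesP => u ut ->; have /andP[hu _] := axis_tile_axis ut.
  rewrite half_turn_diag //; apply/axis_tilesP; exists (a.*2 - u) => //.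
  by rewrite axis_tile_sym //; case/and3P: hu.
apply/setP => L; rewrite mem_mirror; last exact: half_turnK.
apply/idP/idP => [/half|/half //]; rewrite rho_imsetK //; exact: half_turnK.
Qed.

Lemma tiling_axis_tiles A c : tiling e (cover (axis_tiles A c)) (axis_tiles A c).
Proof.
apply/tilingP; split=> [L|L|d|L L' d].
- case/axis_tilesP => u ut ->; have /andP[hu _] := axis_tile_axis ut.
  by exists (cell_at a b u (a + b - u) true), (cell_at a b u (a + b - u) false); rewrite share_edge_diag.
- exact: bigcup_sup.
- by case/bigcupP => L; exists L.
- case/axis_tilesP => u ut -> /axis_tilesP[u' ut' ->].
  have /andP[hu _] := axis_tile_axis ut; have /andP[hu' _] := axis_tile_axis ut'.
  move: hu hu'; rewrite /on_axis => hu hu'.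
  rewrite !inE => /orP[]/eqP-> /orP[]/eqP/cell_at_inj[]; try lia; by move=> ->.
Qed.

Lemma cover_axis_tiles A c : cover (axis_tiles A c) \subset R.
Proof.
apply/bigcupsP => L /axis_tilesP[u ut ->].
by have /andP[] := axis_tile_axis ut.
Qed.

Lemma low_axis_tiles A c :
  (R :&: low) :\: cover (axis_tiles A c) =
  below_up y a b k (a + b) (fun u => ~~ axis_tile A c u).
Proof.
apply/setP => d; rewrite in_setD in_setI [RHS]inE.
case: (boolP (d \in R)) => /= dR; last by rewrite andbF.
have -> : (d \in cover (axis_tiles A c)) =
    (d.1.1 + d.1.2 == a + b) && axis_tile A c d.1.1.
  apply/bigcupP/andP => [[L /axis_tilesP[u ut ->]]|[/eqP lev ut]].
    have /andP[/and3P[hu1 hu2 hu3] _] := axis_tile_axis ut.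
    by rewrite !inE => /orP[]/eqP->; rewrite /= !inordK; (try by lia); split=> //; lia.
  exists (diag d.1.1); first by apply/axis_tilesP; exists d.1.1.
  have hd : d = cell_at a b d.1.1 (a + b - d.1.1) d.2.
    by case: d {dR ut} lev => -[u v] up /= lev; rewrite [LHS]cell_atE /=; congr cell_at; lia.
  by rewrite {1}hd !inE; case: (d.2); rewrite eqxx ?orbT.
case: d dR => -[u v] up /= _; rewrite inE /=.
by case: (axis_tile _ _ _); rewrite ?andbT ?andbF ?orbF ?orbT; case: up; lia.
Qed.

(** Straddling tiles lie on axis rhombi. They come in pairs symmetric about the center, apart from
    the central one, and only distances from [k + 1] to [minn a b] are possible; so [A] and [c]
    encode all of them, and each fiber is counted by a lower half. *)
Lemma M_odot_axis :
  M_odot R = \sum_(A : {set 'I_h}) \sum_(c : bool)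
    tilings e (below_up y a b k (a + b) (fun u => ~~ axis_tile A c u)).
Proof.
pose A_of (T : {set {set C}}) := [set j : 'I_h | diag (a + k.+1 + j) \notin T].
pose c_of (T : {set {set C}}) := diag a \notin T.
rewrite pair_big /M_odot -sum1dep_card (partition_big (fun T => (A_of T, c_of T)) predT) //=.
apply: eq_bigr => -[A c] _; rewrite -low_axis_tiles.
rewrite -(@card_symmetric_tilings _ e rho low (@half_turnK _ _) (@share_edge_half_turn _ _)
   low_half_turn _ _ half_turn_region (tiling_axis_tiles A c) (cover_axis_tiles A c)
   (mirror_axis_tiles A c)); last first.
  by move=> L /axis_tilesP[u ut ->]; apply: straddling_diag; case/andP: (axis_tile_axis ut).
rewrite sum1dep_card; apply: eq_card => T; rewrite !inE -andbA is_tilingE.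
apply: andb_id2l => tT; rewrite /centrally_symmetric -/(mirror rho T).
apply: andb_id2l => /eqP symT.
have minE := geq_minl a b; have minE' := geq_minr a b.
have axis_j (j : 'I_h) : on_axis (a + k.+1 + j).
  by have := ltn_ord j; rewrite /on_axis; lia.
have axis_a : on_axis a by rewrite /on_axis; lia.
have [lT sT cT uT] := tilingP _ _ _ tT.
have diag_sym u : on_axis u -> (diag (a.*2 - u) \in T) = (diag u \in T).
  by move=> hu; rewrite -half_turn_diag // -mem_mirror ?symT //; apply: half_turnK.
apply/eqP/eqP => [[<- <-]|eX].
  apply/setP => L; rewrite inE; apply/andP/axis_tilesP => [[LT strL]|[u ut ->]].
    have [d [d' [ed eL]]] := lT _ LT; have [u hu eLu] := straddlingP ed eL strL.
    exists u => //; have := sT _ LT; rewrite eLu diag_region // => uR.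
    rewrite /axis_tile /c_of negbK; have [eua|nua] := eqVneq u a; first by move: LT; rewrite eLu eua => ->.
    apply/existsP => /=; rewrite /on_axis in hu.
    have [lt|gt] : u < a \/ a < u by lia.
      (* [A_of] inspects one side of the center only, so a tile on the other side is traded for its
         mirror image. *)
      have hj : a - u - k.+1 < h by lia.
      exists (Ordinal hj); rewrite inE negbK /=; apply/andP; split; last lia.
      have -> : a + k.+1 + (a - u - k.+1) = a.*2 - u by lia.
      by rewrite diag_sym // -eLu.
    have hj : u - a - k.+1 < h by lia.
    exists (Ordinal hj); rewrite inE negbK /=; apply/andP; split; last lia.
    rewrite (_ : a + k.+1 + _ = u) -?eLu //; lia.
  have /andP[hu _] := axis_tile_axis ut; split; last exact: straddling_diag.
  case/orP: ut => [/andP[/eqP->]|/existsP[j]]; first by rewrite negbK.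
  rewrite inE negbK => /andP[jT /orP[]/eqP eu]; first by rewrite eu.
  by rewrite -diag_sym // (_ : a.*2 - u = a + k.+1 + j) //; lia.
have memX u : on_axis u -> (diag u \in T) = axis_tile A c u.
  by move=> hu; rewrite -mem_axis_tiles // -eX inE straddling_diag // andbT.
congr (_, _).
  apply/setP => j; rewrite inE memX // /axis_tile.
  have -> : (a + k.+1 + j == a) = false by lia.
  apply/idP/idP => [/= /existsPn/(_ j)|jA]; first by rewrite eqxx andbT negbK.
  apply/existsPn => i; apply/negP => /andP[iA /orP[]/eqP]; last lia.
  by move/addnI => /val_inj eij; rewrite -eij jA in iA.
rewrite /c_of memX // /axis_tile eqxx /=; case: c {eX memX} => //=.
by apply/existsPn => i; apply/negP => /andP[iA]; lia.
Qed.

End Halving.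

Local Open Scope ring_scope.

(** * Determinants *)

Lemma det_sum_rows (F : comNzRingType) n (E : finType) (c : 'I_n -> E -> 'I_n -> F) :
  \det (\matrix_(i, j) \sum_b c i b j) =
    \sum_(f : {ffun 'I_n -> E}) \det (\matrix_(i, j) c i (f i) j).
Proof.
rewrite /determinant exchange_big /=; apply: eq_bigr => s _.
rewrite -mulr_sumr; congr (_ * _).
under eq_bigr => i _ do rewrite mxE.
rewrite (bigA_distr_bigA (fun i b => c i b (s i))).
by apply: eq_bigr => f _; apply: eq_bigr => i _; rewrite mxE.
Qed.

Lemma det_rows_scale (F : comNzRingType) n (w : 'I_n -> F) (m : 'I_n -> 'I_n -> F) :
  \det (\matrix_(i, j) (w i * m i j)) = (\prod_i w i) * \det (\matrix_(i, j) m i j).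
Proof.
rewrite (_ : (\matrix_(i, j) (w i * m i j)) = diag_mx (\row_i w i) *m (\matrix_(i, j) m i j)).
  by rewrite det_mulmx det_diag; under eq_bigr do rewrite mxE.
by apply/matrixP => i j; rewrite mul_diag_mx !mxE.
Qed.

Lemma det_cols_scale (F : comNzRingType) n (w : 'I_n -> F) (m : 'I_n -> 'I_n -> F) :
  \det (\matrix_(i, j) (w j * m i j)) = (\prod_i w i) * \det (\matrix_(i, j) m i j).
Proof.
rewrite -det_tr -[in RHS]det_tr -(_ : \matrix_(i, j) m j i = (\matrix_(i, j) m i j)^T).
  by rewrite -det_rows_scale; congr (\det _); apply/matrixP => i j; rewrite !mxE.
by apply/matrixP => i j; rewrite !mxE.
Qed.

Definition vandermonde (F : comNzRingType) n (x : 'I_n -> F) : F :=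
  \prod_(i < n) \prod_(j < n | (i < j)%N) (x j - x i).

Section PolyEval.
Variables (F : comNzRingType) (n : nat) (q : 'I_n -> {poly F}).
Hypothesis size_q : forall j, (size (q j) <= n)%N.

Lemma det_poly_coef (x : 'I_n -> F) :
  \det (\matrix_(i, j) (q j).[x i]) = vandermonde x * \det (\matrix_(i, j) (q j)`_i).
Proof.
rewrite (_ : \matrix_(i, j) _ =
   (Vandermonde n (\row_i x i))^T *m (\matrix_(i, j) (q j)`_i)); last first.
  apply/matrixP => i j; rewrite !mxE (horner_coef_wide _ (size_q j)).
  by apply: eq_bigr => l _; rewrite !mxE mulrC.
rewrite det_mulmx det_tr det_Vandermonde; congr (_ * _).
by apply: eq_bigr => i _; apply: eq_bigr => j _; rewrite !mxE.
Qed.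

(** Eliminates the determinant of coefficients: the value at arbitrary points follows from the value
    at one convenient family, without computing any coefficient. *)
Lemma det_poly_eval (x z : 'I_n -> F) :
  \det (\matrix_(i, j) (q j).[x i]) * vandermonde z =
  \det (\matrix_(i, j) (q j).[z i]) * vandermonde x.
Proof. by rewrite !det_poly_coef; ring. Qed.
End PolyEval.

Lemma vandermonde_neq0 (F : idomainType) n (x : 'I_n -> F) :
  injective x -> vandermonde x != 0.
Proof.
move=> inj; apply/prodf_neq0 => i _; apply/prodf_neq0 => j ij.
by rewrite subr_eq0 (inj_eq inj); apply: contraTneq ij => ->; rewrite ltnn.
Qed.

Lemma vandermonde_eq0 (F : comNzRingType) n (x : 'I_n -> F) i j :
  i != j -> x i = x j -> vandermonde x = 0.
Proof.
wlog ij : i j / (i < j)%N => [hw ne eij|_ eij].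
  have /orP[lt|lt] : (i < j)%N || (j < i)%N by rewrite -neq_ltn.
    exact: hw lt ne eij.
  by apply: hw lt _ _; rewrite 1?eq_sym.
by rewrite /vandermonde (bigD1 i) //= (bigD1 j) //= eij subrr !mul0r.
Qed.

Lemma vandermonde_ord (F : comNzRingType) n :
  vandermonde (fun i : 'I_n => i%:R : F) = \prod_(i < n) i`!%:R.
Proof.
elim: n => [|n IH]; first by rewrite /vandermonde !big_ord0.
rewrite /vandermonde big_ord_recl /= [RHS]big_ord_recr /= mulrC; congr (_ * _).
  rewrite -IH; apply: eq_bigr => i _.
  rewrite [LHS]big_mkcond big_ord_recl /= mul1r -big_mkcond /=.
  by apply: eq_big => j // _; rewrite /bump !add1n -!natr1; ring.
rewrite big_mkcond big_ord_recl /= mul1r fact_prod big_add1 /= big_mkord natr_prod.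
by apply: eq_bigr => i _; rewrite /bump add1n subr0.
Qed.

(* The binomial coefficient [C(N, s - i)], which must vanish for [s < i]. *)
Definition step_paths (N s i : nat) : nat := if (i <= s)%N then 'C(N, s - i) else 0%N.

Definition paths_mx N n (s : 'I_n -> nat) : 'M[rat]_n :=
  \matrix_(j, i) (step_paths N (s j) i)%:R.

(** The part of [C(N, s - i)] independent of [i], up to [N!]. The value 0 beyond [L] makes the
    factorization [step_paths_poly] valid for every [s]. *)
Definition end_weight (L s : nat) : rat :=
  if (s <= L)%N then (s`! * (L - s)`!)%:R^-1 else 0.

Lemma end_weight_ge0 L s : 0 <= end_weight L s.
Proof. by rewrite /end_weight; case: ifP => // _; rewrite invr_ge0 ler0n. Qed.

Definition path_poly L n (i : 'I_n) : {poly rat} :=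
  (\prod_(t < i) ('X - t%:R%:P)) * \prod_(t < n.-1 - i) ((L%:R - t%:R)%:P - 'X).

Lemma size_path_poly L n (i : 'I_n) : (size (path_poly L i) <= n)%N.
Proof.
apply: leq_trans (size_polyMleq _ _) _.
have h1 : (size (\prod_(t < i) ('X - (t%:R : rat)%:P))%R <= i.+1)%N.
  by rewrite size_prod_XsubC /index_enum -enumT size_enum_ord.
have h2 : (size (\prod_(t < n.-1 - i) ((L%:R - t%:R : rat)%:P - 'X))%R <= (n.-1 - i).+1)%N.
  apply: leq_trans (size_poly_prod_leq _ _) _.
  rewrite (eq_bigr (fun _ => 2%N)) => [|t _]; last by rewrite -size_polyN opprB size_XsubC.
  by rewrite sum_nat_const card_ord; lia.
rewrite -subn1 leq_subLR; apply: leq_trans (leq_add h1 h2) _.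
by have := ltn_ord i; lia.
Qed.

Lemma prod_ffactr (s i : nat) : (i <= s.+1)%N -> \prod_(t < i) (s%:R - t%:R : rat) = (s ^_ i)%:R.
Proof.
rewrite ffact_prod natr_prod => h; apply: eq_bigr => t _; rewrite natrB //.
by have := ltn_ord t; lia.
Qed.

Lemma ffactr (s i : nat) : \prod_(t < i) (s%:R - t%:R : rat) = (s ^_ i)%:R.
Proof.
have [h|h] := leqP i s; first by apply: prod_ffactr; lia.
by rewrite ffact_small // (bigD1 (Ordinal h)) //= subrr mul0r.
Qed.

(** The quotients [s! / (s - i)!] and [(L - s)! / (N - (s - i))!] are falling factorials of total
    degree [n - 1] in [s]; for [s <= L] they vanish exactly where the binomial coefficient does. *)
Lemma step_paths_poly N n (s : nat) (i : 'I_n) : let L := (N + n.-1)%N in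
  (step_paths N s i)%:R = N`!%:R * end_weight L s * (path_poly L i).[s%:R].
Proof.
move=> L; have lt_in := ltn_ord i; rewrite /step_paths /end_weight.
have [sL|Ls] := leqP s L; last first.
  by rewrite mulr0 mul0r; case: ifP => // is_; rewrite bin_small //; move: Ls; rewrite /L; lia.
rewrite /path_poly hornerM !horner_prod.
under eq_bigr do rewrite hornerXsubC.
under [X in _ = _ * (_ * X)]eq_bigr do rewrite !hornerE.
rewrite ffactr.
have -> : \prod_(t < n.-1 - i) (L%:R - t%:R - s%:R : rat) = ((L - s) ^_ (n.-1 - i))%:R.
  by rewrite -ffactr; apply: eq_bigr => t _; rewrite natrB //; ring.
case: leqP => [is_|si]; last by rewrite (ffact_small si) mul0r mulr0.
have [Nsi|siN] := leqP (s - i) N; last first.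
  by rewrite bin_small // (@ffact_small (L - s)) ?mulr0 //; move: sL; rewrite /L; lia.
have nz m : m`!%:R != 0 :> rat by rewrite pnatr_eq0 -lt0n fact_gt0.
have e1 := bin_fact Nsi; have e2 := ffact_fact is_.
have h3 : (n.-1 - i <= L - s)%N by move: sL; rewrite /L; lia.
have e3 := ffact_fact h3; have e4 : (L - s - (n.-1 - i) = N - (s - i))%N by move: sL; rewrite /L; lia.
rewrite e4 in e3; rewrite -e1 -e2 -e3 !natrM !invfM.
have f1 : (s ^_ i)%:R != 0 :> rat by rewrite pnatr_eq0 -lt0n ffact_gt0.
have f2 : ((L - s) ^_ (n.-1 - i))%:R != 0 :> rat by rewrite pnatr_eq0 -lt0n ffact_gt0.
by field; rewrite !nz f1 f2.
Qed.

Lemma natr_fact_neq0 m : m`!%:R != 0 :> rat.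
Proof. by rewrite pnatr_eq0 -lt0n fact_gt0. Qed.

Lemma end_weight_neq0 L s : (s <= L)%N -> end_weight L s != 0.
Proof. by move=> sL; rewrite /end_weight sL invr_eq0 natrM mulf_neq0 ?natr_fact_neq0. Qed.

(** The constant comes from the end points [s j = j], for which the matrix is lower
    unitriangular. *)
Lemma det_paths_mx N n (s : 'I_n -> nat) : let L := (N + n.-1)%N in
  \det (paths_mx N s) * \prod_(j < n) j`!%:R =
    (\prod_j (end_weight L (s j) / end_weight L j)) *
    vandermonde (fun j => (s j)%:R : rat).
Proof.
move=> L.
have detE (r : 'I_n -> nat) : \det (paths_mx N r) =
    (\prod_j (N`!%:R * end_weight L (r j))) *
    \det (\matrix_(i, j) (path_poly L j).[(r i)%:R]).
  rewrite -det_rows_scale; congr (\det _); apply/matrixP => i j.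
  by rewrite !mxE step_paths_poly.
have det1 : \det (paths_mx N (fun j : 'I_n => j : nat)) = 1.
  rewrite det_trig.
    by rewrite big1 // => i _; rewrite mxE /step_paths leqnn subnn bin0.
  by apply/is_trig_mxP => i j ij; rewrite mxE /step_paths leqNgt ij.
move: det1; rewrite detE.
have := det_poly_eval (@size_path_poly L n) (fun j => (s j)%:R) (fun j => j%:R).
rewrite vandermonde_ord detE => e1.
rewrite -mulrA e1 big_split /= => e2.
rewrite !big_split /= prodfV.
have nz : \prod_(j < n) end_weight L j != 0.
  by apply/prodf_neq0 => j _; apply: end_weight_neq0; have := ltn_ord j; rewrite /L; lia.
move: e2 nz; set A := \prod_(j < n) N`!%:R; set B := \prod_(j < n) end_weight L j.
move: (\det _) (vandermonde _) (\prod_(i < n) end_weight L (s i)) => D V W e2 nz.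
transitivity (A * B * D * (W * V) / B); first by field.
by rewrite e2; field.
Qed.

Lemma norm_det_paths_mx N n (s : 'I_n -> nat) : let L := (N + n.-1)%N in
  `|\det (paths_mx N s)| * \prod_(j < n) j`!%:R =
    (\prod_j (end_weight L (s j) / end_weight L j)) *
    `|vandermonde (fun j => (s j)%:R : rat)|.
Proof.
move=> L; have /(congr1 Num.norm) := det_paths_mx N s; rewrite !normrM.
have -> : `|\prod_(j < n) j`!%:R : rat| = \prod_(j < n) j`!%:R.
  by rewrite ger0_norm // prodr_ge0.
move=> ->; congr (_ * _); rewrite ger0_norm // prodr_ge0 // => j _.
by rewrite divr_ge0 ?end_weight_ge0.
Qed.

(** All factors of [det_paths_mx] other than the Vandermonde product are nonnegative, so unsorted
    end points affect the sign through that product alone. *)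
Lemma sg_det_paths_mx N n (s : 'I_n -> nat) :
  Num.sg (vandermonde (fun j => (s j)%:R : rat)) * \det (paths_mx N s) =
  `|\det (paths_mx N s)|.
Proof.
have nz : \prod_(j < n) j`!%:R != 0 :> rat.
  by apply/prodf_neq0 => j _; apply: natr_fact_neq0.
apply: (mulIf nz); rewrite norm_det_paths_mx -mulrA det_paths_mx.
by rewrite mulrCA normrEsg.
Qed.

(** Distinct integers that each drop by at most one and remain distinct keep their relative order,
    so no factor changes sign. *)
Lemma sg_vandermonde_step n (s : 'I_n -> nat) (eps : 'I_n -> bool) :
  injective s -> injective (fun j => s j - eps j)%N -> (forall j, eps j <= s j)%N ->
  Num.sg (vandermonde (fun j => (s j - eps j)%:R : rat)) =
  Num.sg (vandermonde (fun j => (s j)%:R : rat)).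
Proof.
move=> inj inj' le; rewrite /vandermonde.
have sgM (P : 'I_n -> pred 'I_n) (f : 'I_n -> 'I_n -> rat) :
   Num.sg (\prod_i \prod_(j | P i j) f i j) = \prod_i \prod_(j | P i j) Num.sg (f i j).
  have sg1 I r (Q : pred I) (g : I -> rat) : 
     Num.sg (\prod_(i <- r | Q i) g i) = \prod_(i <- r | Q i) Num.sg (g i).
    by apply: (big_morph Num.sg) => [x z|]; [apply: sgrM | apply: sgr1].
  by rewrite sg1; apply: eq_bigr => i _; rewrite sg1.
rewrite !sgM; apply: eq_bigr => i _; apply: eq_bigr => j ij.
have ne : s i <> s j by move=> /inj e; rewrite e ltnn in ij.
have ne' : (s i - eps i <> s j - eps j)%N by move=> /inj' e; rewrite e ltnn in ij.
have := le i; have := le j => h1 h2.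
have [lt|lt] : (s i < s j /\ s i - eps i < s j - eps j)%N \/
               (s j < s i /\ s j - eps j < s i - eps i)%N.
  by move: ne ne' h1 h2; case: (eps i); case: (eps j) => /=; lia.
  by rewrite !gtr0_sg ?subr_gt0 ?ltr_nat; case: lt.
by rewrite !ltr0_sg ?subr_lt0 ?ltr_nat; case: lt.
Qed.

Lemma step_paths_gt N n s (i : 'I_n) : (N + n.-1 < s)%N -> step_paths N s i = 0%N.
Proof.
move=> lt; rewrite /step_paths; case: ifP => // _; rewrite bin_small //.
by have := ltn_ord i; lia.
Qed.

Lemma step_pathsS N s i :
  step_paths N.+1 s i = (step_paths N s i + (if 0 < s then step_paths N s.-1 i else 0))%N.
Proof.
rewrite /step_paths; case: s => [|s] /=; first by case: i => [|i] //=; rewrite !bin0.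
have [le|lt|->] := ltngtP i s.+1.
- by rewrite -ltnS le subSn // binS.
- by case: leqP => // h; lia.
- by rewrite subnn !bin0 ltnn.
Qed.

(** Pascal's rule and multilinearity give a signed sum. Impossible steps produce a zero row,
    collisions a zero Vandermonde product, and the other terms share one sign, so absolute values
    can be taken termwise. The index set is that of [tilings_below_up]. *)
Lemma norm_det_paths_mxS N n (s : 'I_n -> nat) : injective s ->
  `|\det (paths_mx N.+1 s)| =
   \sum_(eps : {ffun 'I_n -> bool} |
         [forall j, if eps j then 0 < s j else s j <= N + n.-1]%N &&
         injectiveb (fun j => s j - eps j)%N)
     `|\det (paths_mx N (fun j => s j - eps j)%N)|.
Proof.
move=> inj; rewrite -sg_det_paths_mx.
pose c (j : 'I_n) (b : bool) (i : 'I_n) : rat :=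
  (if b then if 0 < s j then step_paths N (s j).-1 i else 0 else step_paths N (s j) i)%N%:R.
have -> : paths_mx N.+1 s = \matrix_(j, i) \sum_b c j b i.
  apply/matrixP => j i; rewrite !mxE step_pathsS natrD.
  by rewrite big_bool /= addrC.
rewrite det_sum_rows mulr_sumr [RHS]big_mkcond /=; apply: eq_bigr => eps _.
case: (boolP [forall j, _]) => [/forallP ok|/forallPn[j nok]] /=; last first.
  rewrite (expand_det_row _ j) big1 ?mulr0 // => i _; rewrite mxE /c.
  case: (eps j) nok => [/negPf->|]; first by rewrite /= mulr0n mul0r.
  by rewrite -ltnNge => lt; rewrite step_paths_gt // mulr0n mul0r.
have -> : \matrix_(j, i) c j (eps j) i = paths_mx N (fun j => s j - eps j)%N.
  apply/matrixP => j i; rewrite !mxE /c; have := ok j; case: (eps j) => [->|_].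
    by rewrite subn1.
  by rewrite subn0.
case: (boolP (injectiveb _)) => [/injectiveP inj'|/injectivePn[i [j ij eij]]].
  rewrite -sg_det_paths_mx sg_vandermonde_step // => j.
  by have := ok j; case: (eps j).
apply/eqP; rewrite mulf_eq0; apply/orP; right.
rewrite -normr_eq0; have /eqP := norm_det_paths_mx N (fun j => s j - eps j)%N.
rewrite (vandermonde_eq0 ij) ?eij // normr0 mulr0 mulf_eq0 => /orP[//|].
by rewrite prodf_seq_eq0 => /hasP[l _]; rewrite (negPf (natr_fact_neq0 _)).
Qed.

Lemma norm_det_paths_mx0 n (s : 'I_n -> nat) : injective s ->
  (forall j, s j < n)%N -> `|\det (paths_mx 0 s)| = 1.
Proof.
move=> inj lt.
pose f j : 'I_n := Ordinal (lt j).
have f_inj : injective f by move=> i j /(congr1 val) /inj.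
have -> : paths_mx 0 s = perm_mx (perm f_inj).
  apply/matrixP => i j; rewrite !mxE /step_paths permE -val_eqE /=.
  by case: ltngtP => // [lt'|->]; [rewrite bin_small // subn_gt0 | rewrite subnn].
by rewrite det_perm normrX normrN1 expr1n.
Qed.

(** * Discrete Selberg sum *)

(** Each permutation in the expansion of the first determinant on the right can be absorbed by
    reindexing [f]; its sign cancels against the permuted rows of the second, leaving [n!] equal
    copies of the row expansion on the left. *)
Lemma andreief (F : comNzRingType) n (E : finType) (p q : 'I_n -> E -> F) :
  n`!%:R * \det (\matrix_(i, j) \sum_b p i b * q j b) =
  \sum_(f : {ffun 'I_n -> E})
     \det (\matrix_(i, j) p j (f i)) * \det (\matrix_(i, j) q j (f i)).
Proof.
rewrite (det_sum_rows (fun i b j => p i b * q j b)).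
under eq_bigr do rewrite det_rows_scale.
have -> : n`! = #|{perm 'I_n}| by rewrite card_Sn.
rewrite [LHS]mulr_natl -sumr_const.
under [RHS]eq_bigr => f _ do rewrite [X in X * _]/determinant mulr_suml.
rewrite [RHS]exchange_big /=; apply: eq_big => [s|s _]; first by rewrite inE.
rewrite [RHS](reindex (fun f : {ffun 'I_n -> E} => [ffun i => f (s i)])) /=; last first.
  exists (fun f : {ffun 'I_n -> E} => [ffun i => f ((s^-1)%g i)]) => f _;
    by apply/ffunP => i; rewrite !ffunE (permK, permKV).
apply: eq_bigr => f _.
rewrite (_ : \matrix_(i, j) q j ([ffun i => f (s i)] i) =
  row_perm s (\matrix_(i, j) q j (f i))); last first.
  by apply/matrixP => i j; rewrite !mxE ffunE.
rewrite row_permE det_mulmx det_perm mulrACA -signr_addb addbb mul1r; congr (_ * _).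
by rewrite (reindex_perm s); apply: eq_bigr => i _; rewrite mxE ffunE.
Qed.

(** For [L = a + b], the end weights at [a + al] and [a - al] together give
    [ball_weight a al * ball_weight b al]. *)
Definition ball_weight (m al : nat) : rat :=
  if (al <= m)%N then ((m + al)`! * (m - al)`!)%:R^-1 else 0.

(** At [al = m + 1] the quadratic factor vanishes exactly where the right-hand side takes its
    default value 0, so the lowering holds for all [al]. *)
Lemma ball_weightS m al :
  ball_weight m.+1 al * (m.+1%:R ^+ 2 - al%:R ^+ 2) = ball_weight m al.
Proof.
rewrite /ball_weight; case: ltngtP => [lt|gt|->]; last by rewrite subrr mulr0 ltnn.
  have le : (al <= m)%N by []; rewrite le.
  rewrite subSn // addSn !factS !natrM.
  have nz i := natr_fact_neq0 i.
  have n1 : (m + al).+1%:R != 0 :> rat by rewrite pnatr_eq0.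
  have n2 : (m - al).+1%:R != 0 :> rat by rewrite pnatr_eq0.
  have e1 : (m + al).+1%:R = m.+1%:R + al%:R :> rat by rewrite -natrD.
  have e2 : (m - al).+1%:R = m.+1%:R - al%:R :> rat by rewrite -natrB ?leqW // subSn.
  rewrite subr_sqr -e1 -e2; move: n1 n2 (nz (m + al)%N) (nz (m - al)%N).
  move: (m + al).+1%:R (m - al).+1%:R (m + al)`!%:R (m - al)`!%:R => s t u v n1 n2 n3 n4.
  by field; rewrite n1 n2 n3 n4.
by rewrite mul0r leqNgt (ltnW gt).
Qed.

(* The weight of the Racah polynomials, on the quadratic lattice [al ^ 2]. *)
Definition racah_weight (K a b al : nat) : rat :=
  2 * al%:R * (\prod_(t < K.+1) (al%:R ^+ 2 - t%:R ^+ 2)) *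
  ball_weight a al * ball_weight b al.

Lemma racah_weight_small K a b al : (al <= K)%N -> racah_weight K a b al = 0.
Proof.
move=> le; rewrite /racah_weight.
have lt : (al < K.+1)%N by [].
by rewrite (bigD1 (Ordinal lt)) //= subrr mul0r mulr0 !mul0r.
Qed.

Lemma natr_factS n : n.+1`!%:R = n.+1%:R * n`!%:R :> rat.
Proof. by rewrite factS natrM. Qed.

Lemma fact_prod_rising m n :
  m`!%:R * \prod_(t < n) (m.+1%:R + t%:R) = (m + n)`!%:R :> rat.
Proof.
elim: n => [|n IH]; first by rewrite big_ord0 mulr1 addn0.
by rewrite big_ord_recr /= mulrA IH addnS factS natrM mulrC -natrD addSn.
Qed.

Lemma prod_sqr_diff K :
  \prod_(t < K.+1) (K.+1%:R ^+ 2 - t%:R ^+ 2 : rat) = K.+1%:R * (K.*2.+1)`!%:R.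
Proof.
under eq_bigr do rewrite subr_sqr.
rewrite big_split /= ffactr ffactnn.
have -> : \prod_(t < K.+1) (K.+1%:R + t%:R : rat) = (K.*2.+1)`!%:R / K`!%:R.
  apply: (mulIf (natr_fact_neq0 K)); rewrite divfK ?natr_fact_neq0 // mulrC.
  by rewrite fact_prod_rising; congr (_`!%:R); lia.
by rewrite factS natrM; field; rewrite natr_fact_neq0.
Qed.

Definition racah_sum (M K a b : nat) : rat := \sum_(al < M) racah_weight K a b al.

(* Both sides expand the factor [b^2 - (K+1)^2] as
   [(al^2 - (K+1)^2) + (b^2 - al^2)] under the sum. *)
Lemma racah_sum_rec M K a b :
  (b.+1%:R ^+ 2 - K.+1%:R ^+ 2) * racah_sum M K a b.+1 =
  racah_sum M K.+1 a b.+1 + racah_sum M K a b.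
Proof.
rewrite /racah_sum mulr_sumr -big_split /=; apply: eq_bigr => al _.
by rewrite /racah_weight [in RHS]big_ord_recr /= -(ball_weightS b); ring.
Qed.

(** Induction on [d]: both terms of the recurrence have the smaller [d], one of them with [K]
    raised. For [d = 0] only [al = K + 1] can contribute, the product killing smaller values and
    [ball_weight] larger ones. The bound on [M] puts the whole support in range. *)
Lemma racah_sumE M K a d : (0 < a)%N -> (minn a (K.+1 + d) < M)%N ->
  racah_sum M K a (K.+1 + d) =
  K.+1`!%:R * 'C(a.-1 + d, d)%:R * (a ^_ K.+1)%:R /
  (a`!%:R * (K + d)`!%:R * (a + (K.+1 + d))`!%:R).
Proof.
case: a => // a _; elim: d K => [|d IH] K hM.
  rewrite !addn0 bin0 /racah_sum.
  rewrite addn0 in hM; have [aK|Ka] := ltnP a.+1 K.+1.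
    rewrite ffact_small // mulr0 mul0r big1 // => al _.
    have [le|gt] := leqP al K; first exact: racah_weight_small.
    by rewrite /racah_weight /ball_weight ifF ?mulr0 ?mul0r //; lia.
  have KM : (K.+1 < M)%N by move: hM; rewrite (minn_idPr Ka).
  rewrite (bigD1 (Ordinal KM)) //= big1 ?addr0 => [|al ne]; last first.
    have [le|gt] := leqP al K; first exact: racah_weight_small.
    rewrite /racah_weight [ball_weight K.+1 _]/ball_weight ifF ?mulr0 //.
    by move: ne; rewrite -val_eqE /=; lia.
  rewrite /racah_weight prod_sqr_diff /ball_weight Ka leqnn subnn fact0 muln1.
  rewrite (_ : K.+1 + K.+1 = (K.*2.+1).+1)%N; last lia.
  have n2 : (a.+1 ^_ K.+1)%:R != 0 :> rat by rewrite pnatr_eq0 -lt0n ffact_gt0.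
  have n3 : 1 + K%:R != 0 :> rat by rewrite nat1r pnatr_eq0.
  have e2 : K.*2.+2%:R = 2 * K.+1%:R :> rat by rewrite -natrM; congr (_%:R); lia.
  have eF : K.*2.+2`!%:R = 2 * K.+1%:R * K.*2.+1`!%:R :> rat by rewrite natr_factS e2.
  have eG := natr_factS K; have eA : a.+1`!%:R = (a.+1 ^_ K.+1)%:R * (a.+1 - K.+1)`!%:R :> rat.
    by rewrite -natrM ffact_fact.
  move: eF eG eA n2 (natr_fact_neq0 K) (natr_fact_neq0 K.*2.+1).
  move: (natr_fact_neq0 (a.+1 + K.+1)) (natr_fact_neq0 (a.+1 - K.+1)).
  move: K.*2.+2`! K.+1`! a.+1`! K`! K.*2.+1`! (a.+1 ^_ K.+1)%N (a.+1 + K.+1)`! (a.+1 - K.+1)`!.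
  move=> u1 u2 u3 u4 u5 u6 u7 u8 n7 n8 eF eG eA n6 n4 n5.
  rewrite !natrM eF eG eA.
  by field; rewrite n3 n4 n5 n6 n7 n8.
have rec := racah_sum_rec M K a.+1 (K.+1 + d).
have h1 : (minn a.+1 (K.+1 + d) < M)%N by lia.
have h2 : (minn a.+1 (K.+2 + d) < M)%N by lia.
have e : ((K.+1 + d).+1%:R ^+ 2 - K.+1%:R ^+ 2 != 0 :> rat).
  rewrite subr_sqr; apply: mulf_neq0; last by rewrite lt0r_neq0 // addr_gt0 ?ltr0n.
  by rewrite subr_eq0 eqr_nat; lia.
rewrite addnS; apply: (mulfI e); rewrite rec (IH K h1).
rewrite (_ : (K.+1 + d).+1 = K.+2 + d)%N // (IH K.+1 h2) /=.
have nz i := natr_fact_neq0 i.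
rewrite (_ : a + d.+1 = (a + d).+1)%N; last lia.
have eb : d.+1%:R * 'C((a + d).+1, d.+1)%:R = (a + d).+1%:R * 'C(a + d, d)%:R :> rat.
  by rewrite -!natrM mul_bin_diag.
have ef : (a.+1 ^_ K.+2)%:R = (a.+1 ^_ K.+1)%:R * (a.+1%:R - K.+1%:R) :> rat.
  rewrite ffactnSr natrM; have [lt|le] := ltnP a.+1 K.+1; last by rewrite natrB.
  by rewrite ffact_small // !mul0r.
rewrite ef.
rewrite (_ : K.+1 + d = (K + d).+1)%N // (_ : a.+1 + (K.+2 + d) = (a.+1 + (K.+1 + d)).+1)%N; last lia.
rewrite (_ : K + d.+1 = (K + d).+1)%N; last lia.
rewrite (_ : K.+2 + d = (K + d).+2)%N //.
set A := (a.+1 + (K.+1 + d))%N.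
have -> : 'C((a + d).+1, d.+1)%:R = (a + d).+1%:R * 'C(a + d, d)%:R / d.+1%:R :> rat.
  by rewrite -eb mulrC mulKf ?pnatr_eq0.
have n1 : A.+1%:R != 0 :> rat by rewrite pnatr_eq0.
have n2 : (K + d).+1%:R != 0 :> rat by rewrite pnatr_eq0.
have n3 : d.+1%:R != 0 :> rat by rewrite pnatr_eq0.
have eA : A.+1%:R = a%:R + K%:R + d%:R + 3 :> rat.
  by rewrite -!natrD; congr (_%:R); rewrite /A; lia.
have eKd : (K + d).+1%:R = K%:R + d%:R + 1 :> rat by rewrite -natr1 natrD.
have eKd2 : (K + d).+2%:R = K%:R + d%:R + 2 :> rat by rewrite -!natrD; congr (_%:R); lia.
have ead : (a + d).+1%:R = a%:R + d%:R + 1 :> rat by rewrite -natr1 natrD.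
have ed : d.+1%:R = d%:R + 1 :> rat by rewrite -natr1.
have eK : K.+1%:R = K%:R + 1 :> rat by rewrite -natr1.
have eK2 : K.+2%:R = K%:R + 2 :> rat by rewrite -!natrD; congr (_%:R); lia.
have ea : a.+1%:R = a%:R + 1 :> rat by rewrite -natr1.
have eF1 := natr_factS A; have eF2 := natr_factS (K + d); have eF3 := natr_factS K.+1.
move: (natr_fact_neq0 A) (natr_fact_neq0 (K + d)) (natr_fact_neq0 a.+1) eF1 eF2 eF3.
move: A.+1`! A`! (K + d).+1`! (K + d)`! K.+2`! K.+1`! a.+1`! (a.+1 ^_ K.+1)%N.
move=> u1 u2 u3 u4 u5 u6 u7 u8 n4 n5 n6 -> -> ->.
move: n1 n2 n3; rewrite eA eKd2 eKd ead ed eK eK2 ea.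
move: (a%:R : rat) (K%:R : rat) (d%:R : rat) => x z t n1 n2 n3.
by field; rewrite n4 n5 n6 /=; apply/and3P; split; [move: n1|move: n2|move: n3]; apply: contra => /eqP e0; apply/eqP; lra.
Qed.

(** * Vandermonde products over symmetric point sets *)

Lemma vandermonde_split (F : comNzRingType) m n (x : 'I_(m + n) -> F) :
  vandermonde x = vandermonde (fun i => x (lshift n i)) *
    vandermonde (fun j => x (rshift m j)) *
    \prod_i \prod_j (x (rshift m j) - x (lshift n i)).
Proof.
rewrite /vandermonde big_split_ord /= [RHS]mulrAC -big_split /=; congr (_ * _).
  apply: eq_bigr => i _; rewrite big_mkcond big_split_ord /= -big_mkcond /=.
  congr (_ * _); apply: eq_bigr => j _.
  by rewrite ifT //; have := ltn_ord i; lia.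
apply: eq_bigr => i _; rewrite big_mkcond big_split_ord /= big1 ?mul1r => [|j _].
  by rewrite -big_mkcond /=; apply: eq_bigl => j; rewrite ltn_add2l.
by rewrite ifF //; have := ltn_ord j; lia.
Qed.

Lemma prod_pairs (F : comNzRingType) n (g : 'I_n -> 'I_n -> F) :
  \prod_i \prod_j g i j =
  (\prod_i g i i) * \prod_(i < n) \prod_(j < n | (i < j)%N) (g i j * g j i).
Proof.
have split3 i : \prod_j g i j =
    g i i * \prod_(j < n | (i < j)%N) g i j * \prod_(j < n | (j < i)%N) g i j.
  rewrite (bigD1 i) //= -mulrA; congr (_ * _).
  rewrite (bigID (fun j : 'I_n => (i < j)%N)) /=; congr (_ * _); apply: eq_bigl => j.
    by rewrite -val_eqE neq_ltn; case: (ltngtP i j).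
  by rewrite -val_eqE neq_ltn; case: (ltngtP i j).
rewrite (eq_bigr _ (fun i _ => split3 i)) !big_split /= -mulrA; congr (_ * _).
rewrite [X in _ * X](exchange_big_dep predT) //= -big_split /=.
by apply: eq_bigr => i _; rewrite -big_split.
Qed.

Lemma norm_vandermonde_affine n (x : 'I_n -> rat) (c : rat) (sgn : bool) :
  `|vandermonde (fun i => c + (-1) ^+ sgn * x i)| = `|vandermonde x|.
Proof.
rewrite /vandermonde !normr_prod; apply: eq_bigr => i _; rewrite !normr_prod.
apply: eq_bigr => j _; rewrite opprD addrACA subrr add0r -mulrBr normrM.
by rewrite normrX normrN1 expr1n mul1r.
Qed.

(* [lshift] and [rshift (lshift)] carry the positions symmetric about [c],
   the last block the positions [c], ..., [c + k]. *)
Lemma norm_vandermonde_symmetric n k (c : rat) (s : 'I_(n + (n + k.+1)) -> rat)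
    (x : 'I_n -> rat) :
  (forall i, s (lshift _ i) = c + x i) ->
  (forall i, s (rshift _ (lshift _ i)) = c - x i) ->
  (forall t, s (rshift _ (rshift _ t)) = c + t%:R) ->
  `|vandermonde s| = (\prod_(t < k.+1) t`!%:R) *
    (vandermonde (fun i => x i ^+ 2)) ^+ 2 *
    \prod_i `|2 * x i * \prod_(t < k.+1) (x i ^+ 2 - t%:R ^+ 2)|.
Proof.
move=> s1 s2 s3.
rewrite !vandermonde_split !normrM.
have -> : `|vandermonde (fun i => s (lshift (n + k.+1) i))| = `|vandermonde x|.
  rewrite -[RHS](norm_vandermonde_affine x c false) /vandermonde; congr `|_|.
  by apply: eq_bigr => i _; apply: eq_bigr => j _; rewrite !s1 !mul1r.
have -> : `|vandermonde (fun i => s (rshift n (lshift k.+1 i)))| = `|vandermonde x|.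
  rewrite -[RHS](norm_vandermonde_affine x c true) /vandermonde; congr `|_|.
  by apply: eq_bigr => i _; apply: eq_bigr => j _; rewrite !s2 !mulN1r.
have -> : `|vandermonde (fun j => s (rshift n (rshift n j)))| = \prod_(t < k.+1) t`!%:R.
  transitivity `|vandermonde (fun t : 'I_k.+1 => t%:R : rat)|.
    rewrite -[RHS](norm_vandermonde_affine _ c false) /vandermonde; congr `|_|.
    by apply: eq_bigr => i _; apply: eq_bigr => j _; rewrite !s3 !mul1r.
  by rewrite vandermonde_ord ger0_norm // prodr_ge0.
have -> : \prod_i \prod_j (s (rshift n j) - s (lshift (n + k.+1) i)) =
   \prod_i (\prod_j (- (x j + x i)) * \prod_(t < k.+1) (t%:R - x i)).
  apply: eq_bigr => i _; rewrite big_split_ord /=; congr (_ * _).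
    by apply: eq_bigr => j _; rewrite s1 s2; ring.
  by apply: eq_bigr => j _; rewrite s1 s3; ring.
have -> : \prod_i \prod_j (s (rshift n (rshift n j)) - s (rshift n (lshift k.+1 i))) =
   \prod_i \prod_(t < k.+1) (t%:R + x i).
  by apply: eq_bigr => i _; apply: eq_bigr => j _; rewrite s2 s3; ring.
(* Between the two symmetric blocks, the diagonal pairs give the factors [2 * x i] and each
   unordered pair gives [(x i + x j)^2]. *)
rewrite big_split /= prod_pairs !normrM.
have -> : `|\prod_(i < n) \prod_(j < n | (i < j)%N) (- (x j + x i) * - (x i + x j))| =
    (\prod_(i < n) \prod_(j < n | (i < j)%N) (x j + x i)) ^+ 2.
  rewrite -prodrXl ger0_norm; last first.
    by apply: prodr_ge0 => i _; apply: prodr_ge0 => j _; rewrite mulrNN [x i + _]addrC sqr_ge0.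
  apply: eq_bigr => i _; rewrite -prodrXl; apply: eq_bigr => j _.
  by rewrite mulrNN [x i + _]addrC.
have -> : vandermonde (fun i => x i ^+ 2) ^+ 2 =
   `|vandermonde x| ^+ 2 * (\prod_(i < n) \prod_(j < n | (i < j)%N) (x j + x i)) ^+ 2.
  rewrite real_normK ?num_real // -exprMn; congr (_ ^+ 2).
  rewrite /vandermonde -big_split; apply: eq_bigr => i _.
  by rewrite -big_split /=; apply: eq_bigr => j _; rewrite subr_sqr.
have -> : \prod_i `|2 * x i * \prod_(t < k.+1) (x i ^+ 2 - t%:R ^+ 2)| =
   `|\prod_i - (x i + x i)| * `|\prod_i \prod_(t < k.+1) (t%:R - x i)| *
   `|\prod_i \prod_(t < k.+1) (t%:R + x i)|.
  rewrite !normr_prod -!big_split /=; apply: eq_bigr => i _.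
  rewrite -!normrM -[in RHS]mulrA -[in RHS]big_split /= normrM [in RHS]normrM; congr (_ * _).
    by rewrite normrN; congr `|_|; ring.
  by rewrite !normr_prod; apply: eq_bigr => t _; rewrite -normrN; congr `|_|; ring.
ring.
Qed.

Definition ratio_poly n (Y c : rat) (j : 'I_n) : {poly rat} :=
  (\prod_(t < n.-1 - j) ((Y - (j + t)%:R)%:P - 'X)) *
  \prod_(t < j) ((Y + c - t%:R)%:P - 'X).

Lemma size_prod_CsubX m (g : 'I_m -> rat) :
  (size (\prod_(t < m) ((g t)%:P - 'X))%R <= m.+1)%N.
Proof.
apply: leq_trans (size_poly_prod_leq _ _) _.
rewrite (eq_bigr (fun _ => 2%N)) => [|t _]; last by rewrite -size_polyN opprB size_XsubC.
by rewrite sum_nat_const card_ord; lia.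
Qed.

Lemma size_ratio_poly n Y c (j : 'I_n) : (size (ratio_poly Y c j) <= n)%N.
Proof.
apply: leq_trans (size_polyMleq _ _) _.
rewrite -subn1 leq_subLR; apply: leq_trans (leq_add (size_prod_CsubX _) (size_prod_CsubX _)) _.
by have := ltn_ord j; lia.
Qed.

Lemma prod_falling m n : (n <= m)%N ->
  (m - n)`!%:R * \prod_(t < n) (m%:R - t%:R) = m`!%:R :> rat.
Proof. by move=> le; rewrite ffactr -natrM mulnC ffact_fact. Qed.

(** Taking [(Y - i - (n - 1))! / (Y + c + 1 - i)!] out of row [i] leaves polynomials in [i] of
    degree [n - 1]. The bound on [Y] keeps all subtractions exact. *)
Lemma norm_det_fact_ratio n Y c : (n.-1.*2 <= Y)%N ->
  `|\det (\matrix_(i < n, j < n) ((Y - i - j)`!%:R / (Y + c.+1 - i - j)`!%:R : rat))| =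
  \prod_(i < n) ((Y - i - n.-1)`!%:R / (Y + c.+1 - i)`!%:R * i`!%:R *
     ((c + (n.-1 - i))`!%:R / c`!%:R)).
Proof.
move=> hY; have nz := natr_fact_neq0.
have -> : \matrix_(i < n, j < n) ((Y - i - j)`!%:R / (Y + c.+1 - i - j)`!%:R : rat) =
  \matrix_(i, j) ((Y - i - n.-1)`!%:R / (Y + c.+1 - i)`!%:R *
     (ratio_poly Y%:R c.+1%:R j).[i%:R]).
  apply/matrixP => i j; rewrite !mxE hornerM !horner_prod.
  have hi := ltn_ord i; have hj := ltn_ord j.
  rewrite (eq_bigr (fun t : 'I_(n.-1 - j) => (Y - i - j)%:R - t%:R)) => [|t _]; last first.
    by rewrite !hornerE natrD !natrB; [ring|lia|lia].
  rewrite [X in _ * (_ * X)](eq_bigr (fun t : 'I_j => (Y + c.+1 - i)%:R - t%:R)) => [|t _]; last first.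
    by rewrite !hornerE natrB ?natrD; [ring|lia].
  have -> : (Y - i - j)`!%:R = (Y - i - n.-1)`!%:R *
      \prod_(t < n.-1 - j) ((Y - i - j)%:R - t%:R) :> rat.
    rewrite -[LHS](@prod_falling _ (n.-1 - j)); last lia.
    by congr (_`!%:R * _); lia.
  have -> : (Y + c.+1 - i)`!%:R = (Y + c.+1 - i - j)`!%:R *
      \prod_(t < j) ((Y + c.+1 - i)%:R - t%:R) :> rat.
    by rewrite (@prod_falling _ j) //; lia.
  have nzp : \prod_(t < j) ((Y + c.+1 - i)%:R - t%:R) != 0 :> rat.
    rewrite ffactr pnatr_eq0 -lt0n ffact_gt0; lia.
  by move: (\prod_(t < j) _) nzp => z nzp; field; rewrite nz nzp.
rewrite det_rows_scale normrM ger0_norm; last by apply: prodr_ge0 => i _; rewrite divr_ge0.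
under [RHS]eq_bigr do rewrite -mulrA.
rewrite [RHS]big_split /=; congr (_ * _).
(* At these reflected points the second product of [ratio_poly] becomes that of the [i - t] for
   [t < j], which is 0 for [i < j]: the matrix is triangular. A reflection preserves the Vandermonde
   product up to sign. *)
pose x (i : 'I_n) : rat := Y%:R + c.+1%:R - i%:R.
have vn0 : `|vandermonde (fun i : 'I_n => i%:R : rat)| != 0.
  rewrite normr_eq0 vandermonde_neq0 // => i j /eqP; rewrite eqr_nat => /eqP; exact: val_inj.
have vx : `|vandermonde x| = `|vandermonde (fun i : 'I_n => i%:R : rat)|.
  rewrite -(norm_vandermonde_affine _ (Y%:R + c.+1%:R) true) /vandermonde; congr `|_|.
  by apply: eq_bigr => i _; apply: eq_bigr => j _; rewrite /x expr1; ring.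
have := det_poly_eval (@size_ratio_poly n Y%:R c.+1%:R) (fun i => i%:R) x.
move/(congr1 Num.norm); rewrite !normrM vx => /(mulIf vn0) ->.
rewrite det_trig; last first.
  apply/is_trig_mxP => i j ij; rewrite mxE hornerM !horner_prod.
  rewrite [X in _ * X](bigD1 (Ordinal ij)) //= [X in _ * (X * _)](_ : _ = 0).
    by rewrite mul0r mulr0.
  by rewrite !hornerE /x subrr.
rewrite normr_prod; apply: eq_bigr => i _; rewrite mxE hornerM !horner_prod normrM mulrC.
congr (_ * _).
  rewrite (eq_bigr (fun t : 'I_i => i%:R - t%:R)) => [|t _]; last by rewrite !hornerE /x; ring.
  by rewrite ffactr ffactnn ger0_norm.
rewrite -fact_prod_rising mulrAC divff // mul1r normr_prod.
apply: eq_bigr => t _ /=; rewrite !hornerE /x (natrD _ i t) -normrN.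
have -> : - (Y%:R - (i%:R + t%:R) - (Y%:R + c.+1%:R - i%:R)) = c.+1%:R + t%:R :> rat by ring.
by rewrite ger0_norm // addr_ge0.
Qed.

(** * Counting half tilings *)

Section Counting.
Variables (y a b k : nat).
Hypotheses (y_gt0 : (0 < y)%N) (y_le_a : (y <= a.*2.+1)%N) (y_le_b : (y <= b.*2.+1)%N).
Hypotheses (yk_le : (y + k <= (a + b).+1)%N) (y_le : (y <= a + b)%N).

Local Notation C := (cell a.*2.+1 b.*2.+1).
Local Notation R := (region y a b k a.*2.+1 b.*2.+1).
Local Notation e := (@share_edge a.*2.+1 b.*2.+1).
Local Notation up_in := (up_in y a b k).
Local Notation down_in := (down_in y a b k).
Local Notation below_up := (below_up y a b k).
Local Notation below_down := (below_down y a b k).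

(** The lowest row of the hexagon consists of [y] downward triangles, each of which must start a
    path; any other number of end points admits no tiling. *)
Definition count_below N r (s : 'I_r -> nat) : rat :=
  if r == y then `|\det (paths_mx N s)| else 0.

Lemma tilings_below_up_step N r (s : 'I_r -> nat) : let t := (y.-1 + N)%N in
  (forall s' : 'I_r -> nat, injective s' ->
     (forall j, s' j <= t /\ down_in (s' j) (t - s' j))%N ->
     (tilings e (below_down t (occupied s')))%:R = count_below N s') ->
  (t < a + b)%N -> injective s ->
  (forall j, s j <= t.+1 /\ up_in (s j) (t.+1 - s j))%N ->
  (tilings e (below_up t.+1 (occupied s)))%:R = count_below N.+1 s.
Proof.
move=> t IH tab inj s_in; rewrite tilings_below_up //; last by rewrite /t; lia.
rewrite natr_sum (eq_bigr (fun eps : {ffun 'I_r -> bool} => count_below N (fun j => s j - eps j)%N)); last first.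
  move=> eps /andP[/forallP ok /injectiveP inj']; apply: IH => // j.
  by have [h1 h2] := s_in j; apply: down_in_step => //; rewrite /t; lia.
rewrite /count_below; case: eqP => [ry|_]; last by rewrite big1.
have -> : t = (N + r.-1)%N by rewrite /t -ry addnC.
by rewrite norm_det_paths_mxS.
Qed.

Lemma tilings_below N r (s : 'I_r -> nat) : let t := (y.-1 + N)%N in
  (t < a + b)%N -> injective s ->
  (forall j, s j <= t /\ down_in (s j) (t - s j))%N ->
  (tilings e (below_down t (occupied s)))%:R = count_below N s.
Proof.
elim: N r s => [|N IH] r s t tab inj s_in.
  (* For [N = 0] only the lowest row is present. If [r = y] every triangle in it is occupied and the
     empty region remains; otherwise an unoccupied one is isolated. *)
  have lt j : (s j < y)%N by have [] := s_in j; rewrite /t; lia.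
  rewrite /count_below; case: eqP => [ry|/eqP ry].
    move: s inj s_in lt; rewrite ry => s inj s_in lt; rewrite norm_det_paths_mx0 //.
    rewrite (_ : below_down _ _ = set0) ?tilings0 //.
    apply/setP => -[[u v] up]; rewrite !inE; case: up => /=.
      by rewrite /up_in /t; lia.
    apply/negP => /andP[dn /orP[|/andP[/eqP uv /occupiedP]]].
      by move: dn; rewrite /down_in /t; lia.
    apply; have uy : (u < y)%N by move: uv; rewrite /t; lia.
    pose f j : 'I_y := Ordinal (lt j).
    have f_inj : injective f by move=> i j /(congr1 val) /inj.
    by exists (invF f_inj (Ordinal uy)); have /(congr1 val) := f_invF f_inj (Ordinal uy).
  pose f j : 'I_y := Ordinal (lt j).
  have f_inj : injective f by move=> i j /(congr1 val) /inj.
  have [u nu] : exists u : 'I_y, u \notin codom f.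
    apply/existsP; rewrite -negb_forall; apply: contra ry => /forallP all_in.
    have := card_codom f_inj; rewrite (eq_card (B := predT)) => [|u]; last by rewrite all_in.
    by rewrite cardT size_enum_ord card_ord => ->.
  have lu := ltn_ord u.
  rewrite (@tilings_isolated _ _ (@share_edge_sym _ _) _ (cell_at a b u (y.-1 - u)%N false)) //.
    rewrite inE cell_at_region; [|lia|lia]; rewrite /= !inordK; [|lia|lia].
    apply/andP; split; first by rewrite /down_in; lia.
    apply/orP; right; apply/andP; split; first by rewrite /t; lia.
    apply: contra nu => /occupiedP[j sj]; apply/codomP; exists j; exact/val_inj.
  move=> [[u' v'] up']; rewrite share_edge_cell_at_down; [|lia|lia].
  rewrite !inE /=; case: up' => //= /andP[h1 h2].
  by exfalso; move: h1; rewrite /up_in /t in h2 *; lia.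
rewrite tilings_below_down; [|rewrite /t; lia|by []].
rewrite /t addnS; apply: tilings_below_up_step => //.
- by move=> s' inj' s_in'; apply: IH => //; move: tab; rewrite /t; lia.
- by move: tab; rewrite /t; lia.
move=> j; have [h1 h2] := s_in j; move: h1 h2; rewrite /t addnS => h1 h2; split=> //.
by move: tab h2; rewrite /up_in /down_in /t; lia.
Qed.

(** The step down from the axis is the last one allowed by [t < a + b]. The total number of steps is
    chosen so that [L = a + b] in the end weights. *)
Lemma tilings_half r (s : 'I_r -> nat) :
  injective s -> (forall j, s j <= a + b /\ up_in (s j) (a + b - s j))%N ->
  (tilings e (below_up (a + b) (occupied s)))%:R = count_below (a + b - y.-1) s.
Proof.
move=> inj s_in; pose N := (a + b - y)%N.
have et : (y.-1 + N).+1 = (a + b)%N by rewrite /N; lia.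
rewrite (_ : a + b - y.-1 = N.+1)%N; last by rewrite /N; lia.
rewrite -[X in below_up X]et; apply: tilings_below_up_step => //; last by rewrite et.
  by move=> s' inj' s_in'; apply: tilings_below => //; rewrite -et.
by rewrite -et.
Qed.

End Counting.

Lemma sum_injective_ffuns (V : comNzRingType) n (T : finType)
    (g : {ffun 'I_n -> T} -> V) (F : {set T} -> V) :
  (forall f : {ffun 'I_n -> T}, injective f -> g f = F [set f i | i : 'I_n]) ->
  (forall f : {ffun 'I_n -> T}, ~~ injectiveb f -> g f = 0) ->
  \sum_f g f = n`!%:R * \sum_(A : {set T} | #|A| == n) F A.
Proof.
move=> gF g0; rewrite (bigID (fun f : {ffun 'I_n -> T} => injectiveb f)) /= addrC big1 ?add0r; last exact: g0.
rewrite (partition_big (fun f : {ffun 'I_n -> T} => [set f i | i : 'I_n]) (fun A => #|A| == n)) /=; last first.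
  by move=> f /injectiveP inj; rewrite card_imset // card_ord.
rewrite mulr_sumr; apply: eq_bigr => A /eqP cA.
rewrite (eq_bigr (fun _ => F A)) => [|f /andP[/injectiveP inj /eqP <-]]; last exact: gF.
rewrite sumr_const -[LHS]mulr_natl; congr (_%:R * _).
transitivity (#|A| ^_ #|'I_n|)%N; last by rewrite cA card_ord ffactnn.
rewrite -card_inj_ffuns_on.
apply: eq_card => f; rewrite !inE andbC unfold_in; apply: andb_id2l => /injectiveP inj.
apply/eqP/forallP => [<- i|fA]; first exact: imset_f.
apply/eqP; rewrite eqEcard card_imset // card_ord cA leqnn andbT.
by apply/subsetP => x /imsetP[i _ ->].
Qed.

(** * End points on the axis *)

Section AxisEnds.
Variables (a b k : nat).
Hypotheses (k_le_a : (k <= a)%N) (k_le_b : (k <= b)%N).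
Local Notation h := (minn a b - k)%N.

(* End points of the paths of a half: the center (if [c]), the [k] positions
   after it, and the pairs symmetric about it that are not axis tiles. *)
Definition axis_ends m (c : bool) (al : 'I_m -> 'I_h) (i : 'I_(m + (m + (c + k)))) : nat :=
  match split i with
  | inl j => (a + k.+1 + al j)%N
  | inr i' => match split i' with
              | inl j => (a - (k.+1 + al j))%N
              | inr t => (a + t + ~~ c)%N
              end
  end.

Arguments axis_ends [m] c al i.

Let minE := geq_minl a b.
Let minE' := geq_minr a b.

Lemma axis_ends_spec m c (al : 'I_m -> 'I_h) i :
  [\/ exists2 j, i = lshift _ j & axis_ends c al i = (a + k.+1 + al j)%N,
      exists2 j, i = rshift _ (lshift _ j) & axis_ends c al i = (a - (k.+1 + al j))%N
    | exists2 t, i = rshift _ (rshift _ t) & axis_ends c al i = (a + t + ~~ c)%N].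
Proof.
rewrite /axis_ends; case: split_ordP => [j ->|i' ->]; first by constructor 1; exists j.
case: split_ordP => [j ->|t ->]; first by constructor 2; exists j.
by constructor 3; exists t.
Qed.

Lemma axis_ends_inj m c (al : 'I_m -> 'I_h) : injective al -> injective (axis_ends c al).
Proof.
case: c => inj i i'.
all: case: (axis_ends_spec al i) => -[j -> ->]; case: (axis_ends_spec al i') => -[j' -> ->] /=;
  have := ltn_ord j; have := ltn_ord j'; try (have := ltn_ord (al j)); try (have := ltn_ord (al j'));
  move=> *; try (by congr lshift; apply/inj/val_inj => /=; lia);
  try (by congr rshift; congr lshift; apply/inj/val_inj => /=; lia);
  try (by congr rshift; congr rshift; apply/val_inj => /=; lia);
  exfalso; change (nat_of_bool true) with 1%N in *; change (nat_of_bool false) with 0%N in *; lia.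
Qed.

Variables (y : nat).
Hypotheses (y_gt0 : (0 < y)%N) (y_le : (y <= a + b)%N).

Lemma axis_ends_in m c (al : 'I_m -> 'I_h) i :
  (axis_ends c al i <= a + b)%N /\ up_in y a b k (axis_ends c al i) (a + b - axis_ends c al i).
Proof.
case: c i => i; case: (axis_ends_spec al i) => -[j _ ->] /=; have := ltn_ord j;
  try (have := ltn_ord (al j)); move=> *;
  change (nat_of_bool true) with 1%N in *; change (nat_of_bool false) with 0%N in *;
  by split; rewrite ?/up_in; lia.
Qed.

(** The positions from [a - k] to [a - 1] are neither ends nor tiles; the hypothesis [up_in]
    excludes them, their upward triangles being removed. *)
Lemma occupied_axis_ends m c (al : 'I_m -> 'I_h) u :
  (u <= a + b)%N -> up_in y a b k u (a + b - u) ->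
  occupied (axis_ends c al) u = ~~ axis_tile [set al i | i : 'I_m] c u.
Proof.
move=> hu uin; apply/occupiedP/idP => [[i eu]|].
  rewrite /axis_tile negb_or; apply/andP; split.
    apply/negP => /andP[/eqP ua nc]; move: eu; rewrite ua.
    case: (axis_ends_spec al i) => -[j _ ->]; rewrite ?nc /=; have := ltn_ord j;
      try (have := ltn_ord (al j)); change (nat_of_bool true) with 1%N; lia.
  apply/existsPn => j; apply/negP => /andP[/negP jA uj]; apply: jA.
  apply/imsetP; move: eu uj; case: (axis_ends_spec al i) => -[j' _ ->] eu uj.
  - exists j' => //; apply/val_inj => /=; lia.
  - exists j' => //; apply/val_inj => /=; have := ltn_ord (al j'); lia.
  - have := ltn_ord j'; move: (j' : nat) eu uj => t; case: (c) => /=;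
    change (nat_of_bool true) with 1%N; change (nat_of_bool false) with 0%N; lia.
rewrite /axis_tile negb_or => /andP[hc /existsPn nA].
have outer (j : 'I_h) : (u == a + k.+1 + j)%N || (u + k.+1 + j == a)%N -> exists i, al i = j.
  move=> uj; have := nA j; rewrite uj andbT negbK => /imsetP[i _ ->]; by exists i.
rewrite /up_in in uin.
have [lt|gt|mid] : [\/ (u + k < a)%N, (a + k < u)%N | (a <= u <= a + k)%N].
  case: (ltnP (a + k) u) => h1; first by constructor 2.
  by case: (ltnP (u + k) a) => h2; [constructor 1 | constructor 3; lia].
- have hj : (a - u - k.+1 < h)%N by lia.
  have [|i ei] := outer (Ordinal hj); first by rewrite /=; lia.
  exists (rshift _ (lshift _ i)); rewrite /axis_ends (unsplitK (inr _)) (unsplitK (inl _)) ei /=; lia.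
- have hj : (u - a - k.+1 < h)%N by lia.
  have [|i ei] := outer (Ordinal hj); first by rewrite /=; lia.
  exists (lshift _ i); rewrite /axis_ends (unsplitK (inl _)) ei /=; lia.
have ht : (u - a - ~~ c < c + k)%N by move: hc; case: (c) => /=;
    change (nat_of_bool true) with 1%N; change (nat_of_bool false) with 0%N; lia.
exists (rshift _ (rshift _ (Ordinal ht))).
rewrite /axis_ends (unsplitK (inr _)) (unsplitK (inr _)) /=.
by move: hc; case: (c) => /=;
    change (nat_of_bool true) with 1%N; change (nat_of_bool false) with 0%N; lia.
Qed.

End AxisEnds.
Arguments axis_ends [a b k m] c al i.

Lemma prod_ball_weight m i al : (i <= m)%N ->
  ball_weight m al * \prod_(t < i) ((m - t)%:R ^+ 2 - al%:R ^+ 2) = ball_weight (m - i) al.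
Proof.
elim: i => [|i IH] le; first by rewrite big_ord0 mulr1 subn0.
rewrite big_ord_recr /= mulrA IH; last exact: ltnW.
by rewrite -subSS subSn // ball_weightS.
Qed.

Definition falling_poly m n (j : 'I_n) : {poly rat} := \prod_(t < j) (((m - t)%:R ^+ 2)%:P - 'X).

(** The [j]-th polynomial has degree [j] and leading coefficient [(-1) ^+ j], so the coefficient
    matrix is triangular. *)
Lemma det_falling_poly m n (x : 'I_n -> rat) :
  \det (\matrix_(i, j) (falling_poly m j).[x i]) =
  (\prod_(i < n) (-1) ^+ i) * vandermonde x.
Proof.
have size_f (j : 'I_n) : (size (falling_poly m j) <= j.+1)%N by apply: size_prod_CsubX.
rewrite det_poly_coef => [|j]; last by apply: leq_trans (size_f j) _.
rewrite mulrC -det_tr det_trig; last first.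
  apply/is_trig_mxP => i j ij; rewrite !mxE nth_default //.
  exact: leq_trans (size_f i) _.
congr (_ * _); apply: eq_bigr => i _; rewrite !mxE /falling_poly.
have -> : \prod_(t < i) (((m - t)%:R ^+ 2)%:P - 'X) =
    (-1) ^+ i *: \prod_(t < i) ('X - ((m - t)%:R ^+ 2)%:P) :> {poly rat}.
  rewrite -mul_polyC rmorphXn rmorphN1 -[in X in _ ^+ X](card_ord i) -prodrN.
  by apply: eq_bigr => t _; rewrite opprB.
have /monicP := monic_prod_XsubC (index_enum 'I_i) predT (fun t : 'I_i => (m - t)%:R ^+ 2 : rat).
rewrite lead_coefE size_prod_XsubC /index_enum -enumT size_enum_ord /= coefZ => ->.
by rewrite mulr1.
Qed.

(** * From sums over end points to a determinant of moments *)

Section ClosedForm.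
Variables (n a b k : nat).
Hypotheses (n_le_a : (n + k <= a)%N) (n_le_b : (n + k <= b)%N).
Hypothesis n_lt : (n + (n + k.+1) <= a + b)%N.

Let y := (n + (n + k.+1))%N.
Local Notation h := (minn a b - k)%N.
Local Notation R := (region y a b k a.*2.+1 b.*2.+1).
Local Notation e := (@share_edge a.*2.+1 b.*2.+1).

Let minE := geq_minl a b.
Let minE' := geq_minr a b.

Let k_le_a : (k <= a)%N. Proof. by lia. Qed.
Let k_le_b : (k <= b)%N. Proof. by lia. Qed.
Let y_gt0 : (0 < y)%N. Proof. by rewrite /y; lia. Qed.

Definition ends (f : {ffun 'I_n -> 'I_h}) : 'I_y -> nat := axis_ends true f.

Lemma tilings_axis_ends m c (al : 'I_m -> 'I_h) : injective al ->
  (tilings e (below_up y a b k (a + b)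
     (fun u => ~~ axis_tile [set al i | i : 'I_m] c u)))%:R =
  count_below y (a + b - y.-1) (axis_ends c al).
Proof.
move=> inj; rewrite -(@tilings_half y a b k) //; try (rewrite /y; lia).
- congr (tilings e _)%:R; apply/setP => -[[u v] up]; rewrite !inE; case: up => //=.
  apply: andb_id2l => uin; congr (_ || _); apply: andb_id2l => /eqP uv.
  have hu : (u <= a + b)%N by rewrite -uv leq_addr.
  have uin' : up_in y a b k u (a + b - u) by rewrite -uv addKn.
  by rewrite (occupied_axis_ends k_le_a k_le_b y_gt0 n_lt).
- exact: axis_ends_inj.
- by move=> j; apply: axis_ends_in => //; rewrite /y; lia.
Qed.

(** There are [2 * #|A| + c + k] end points, and this equals [y = 2 * n + k + 1] only if [c] holds
    and [#|A| = n]. Replacing sets by functions costs [n!]; a non-injective function gives two equal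
    rows. *)
Lemma M_odot_ends :
  n`!%:R * (M_odot R)%:R =
  \sum_(f : {ffun 'I_n -> 'I_h}) `|\det (paths_mx (a + b - y.-1) (ends f))| :> rat.
Proof.
pose F (A : {set 'I_h}) : rat :=
  (tilings e (below_up y a b k (a + b) (fun u => ~~ axis_tile A true u)))%:R.
rewrite (@sum_injective_ffuns _ n _ _ F).
- congr (_ * _); rewrite M_odot_axis //; try (rewrite /y; lia).
  rewrite natr_sum [RHS]big_mkcond; apply: eq_bigr => A _ /=.
  have eA : A = [set enum_val i | i : 'I_#|A|].
    by apply/setP => j; apply/idP/imsetP => [jA|[i _ ->]];
      [exists (enum_rank_in jA j); rewrite ?enum_rankK_in | apply: enum_valP].
  rewrite big_bool natrD /F.
  have inj : injective (fun i : 'I_#|A| => enum_val i) by apply: enum_val_inj.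
  have ht c := @tilings_axis_ends _ c _ inj; rewrite -eA in ht.
  rewrite !ht /count_below [X in _ + X]ifF ?addr0; last first.
    by apply/negP => /eqP; rewrite /y; lia.
  case: (boolP (#|A| == n)) => // cA; rewrite ifF //.
  apply/negP => /eqP; change (true + k)%N with k.+1.
  by rewrite /y; move: cA; lia.
- move=> f inj; rewrite /F tilings_axis_ends // /count_below ifT //.
move=> f /injectivePn[i [j ij eij]].
have ne : lshift (n + k.+1) i != lshift (n + k.+1) j.
  by apply: contra ij => /eqP/lshift_inj ->.
rewrite (determinant_alternate ne) ?normr0 // => l.
by rewrite !mxE /ends /axis_ends !(unsplitK (inl _)) eij.
Qed.

Lemma norm_det_ends (f : {ffun 'I_n -> 'I_h}) :
  let x i := (k.+1 + f i)%N in
  `|\det (paths_mx (a + b - y.-1) (ends f))| =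
  (\prod_(j < y) (a + b - j)`!%:R) *
  (\prod_(t < k.+1) (t`!%:R * end_weight (a + b) (a + t))) *
  ((\prod_i racah_weight k a b (x i)) * (vandermonde (fun i => (x i)%:R ^+ 2)) ^+ 2).
Proof.
move=> x; have := norm_det_paths_mx (a + b - y.-1) (ends f).
have -> : (a + b - y.-1 + y.-1 = a + b)%N by rewrite /y; lia.
rewrite (@norm_vandermonde_symmetric n k a%:R _ (fun i => (x i)%:R)); first last.
- move=> t; rewrite /ends /axis_ends (unsplitK (inr _)) (unsplitK (inr _)).
  by rewrite /= addn0 natrD.
- move=> i; rewrite /ends /axis_ends (unsplitK (inr _)) (unsplitK (inl _)).
  by rewrite natrB //; have := ltn_ord (f i); lia.
- by move=> i; rewrite /ends /axis_ends (unsplitK (inl _)) -natrD /x addnA.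
cbv zeta.
have -> : \prod_(j < y) (end_weight (a + b) (ends f j) / end_weight (a + b) j) =
  \prod_(j < y) end_weight (a + b) (ends f j) / \prod_(j < y) end_weight (a + b) j.
  by rewrite big_split /= prodfV.
have -> : \prod_(j < y) end_weight (a + b) (ends f j) =
  (\prod_i (ball_weight a (x i) * ball_weight b (x i))) *
  \prod_(t < k.+1) end_weight (a + b) (a + t).
  rewrite {1}/y big_split_ord /= big_split_ord /= mulrA -big_split /=; congr (_ * _).
    apply: eq_bigr => i _.
    rewrite /ends /axis_ends (unsplitK (inl _)) (unsplitK (inr _)) (unsplitK (inl _)).
    have hi := ltn_ord (f i); have xa : (x i <= a)%N by rewrite /x; lia.
    have xb : (x i <= b)%N by rewrite /x; lia.
    rewrite /end_weight /ball_weight xa xb !ifT; try (rewrite /x in xa xb *; lia).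
    rewrite (_ : a + b - (a + k.+1 + f i) = b - x i)%N; last by rewrite /x; lia.
    rewrite (_ : a + b - (a - (k.+1 + f i)) = b + x i)%N; last by rewrite /x in xa xb *; lia.
    rewrite (_ : a + k.+1 + f i = a + x i)%N; last by rewrite /x; lia.
    by rewrite -/(x i) !natrM !invfM; ring.
  apply: eq_bigr => t _; rewrite /ends /axis_ends (unsplitK (inr _)) (unsplitK (inr _)).
  by rewrite /= addn0.
have nzf : \prod_(j < y) j`!%:R != 0 :> rat by apply/prodf_neq0 => j _; apply: natr_fact_neq0.
have nzg : \prod_(j < y) (a + b - j)`!%:R != 0 :> rat.
  by apply/prodf_neq0 => j _; apply: natr_fact_neq0.
have -> : \prod_(j < y) end_weight (a + b) j =
  (\prod_(j < y) j`!%:R)^-1 * (\prod_(j < y) (a + b - j)`!%:R)^-1.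
  rewrite -!prodfV -big_split; apply: eq_bigr => j _ /=; rewrite /end_weight ifT ?natrM ?invfM //.
  by have := ltn_ord j; move: n_lt; rewrite /y; lia.
have -> : \prod_i racah_weight k a b (x i) =
  (\prod_i (ball_weight a (x i) * ball_weight b (x i))) *
  \prod_i `|2 * (x i)%:R * \prod_(t < k.+1) ((x i)%:R ^+ 2 - t%:R ^+ 2)|.
  rewrite -big_split; apply: eq_bigr => i _; rewrite /racah_weight /= ger0_norm; first by ring.
  apply: mulr_ge0; first by rewrite mulr_ge0.
  apply: prodr_ge0 => t _; rewrite subr_ge0 -!natrX ler_nat leq_exp2r //.
  by have := ltn_ord t; rewrite /x; lia.
have -> : \prod_(t < k.+1) (t`!%:R * end_weight (a + b) (a + t)) =
  (\prod_(t < k.+1) t`!%:R) * \prod_(t < k.+1) end_weight (a + b) (a + t).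
  by rewrite big_split.
move=> e1; apply: (mulIf nzf); rewrite e1 invfM !invrK; ring.
Qed.

Lemma M_odot_det :
  (M_odot R)%:R =
  (\prod_(j < y) (a + b - j)`!%:R) *
  (\prod_(t < k.+1) (t`!%:R * end_weight (a + b) (a + t))) *
  \det (\matrix_(i < n, j < n) racah_sum (minn a b).+1 k (a - i) (b - j)) :> rat.
Proof.
apply: (mulfI (natr_fact_neq0 n)); rewrite M_odot_ends.
under eq_bigr do rewrite norm_det_ends.
rewrite -mulr_sumr mulrCA; congr (_ * _).
have -> : \matrix_(i < n, j < n) racah_sum (minn a b).+1 k (a - i) (b - j) =
  \matrix_(i, j) \sum_(c : 'I_h)
    (racah_weight k a b (k.+1 + c) * (falling_poly a i).[(k.+1 + c)%:R ^+ 2]) *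
    (falling_poly b j).[(k.+1 + c)%:R ^+ 2].
  apply/matrixP => i j; rewrite !mxE /racah_sum.
  have hi := ltn_ord i; have hj := ltn_ord j.
  (* The terms [al <= k] of the total mass vanish, leaving exactly the distances indexed by
     ['I_h]. *)
  have -> : (minn a b).+1 = (k.+1 + h)%N by lia.
  rewrite big_split_ord /= big1 ?add0r => [|t _]; last first.
    by apply: racah_weight_small; have := ltn_ord t; rewrite ltnS.
  apply: eq_bigr => c _; rewrite !horner_prod.
  under [X in _ = _ * X * _]eq_bigr do rewrite !hornerE.
  under [X in _ = _ * X]eq_bigr do rewrite !hornerE.
  rewrite /racah_weight -(prod_ball_weight (m := a) (i := i)); last lia.
  rewrite -(prod_ball_weight (m := b) (i := j)); last lia.
  ring.
rewrite (andreief (fun i (c : 'I_h) => racah_weight k a b (k.+1 + c) * (falling_poly a i).[(k.+1 + c)%:R ^+ 2])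
   (fun j (c : 'I_h) => (falling_poly b j).[(k.+1 + c)%:R ^+ 2])).
apply: eq_bigr => f _.
rewrite (det_rows_scale (fun i => racah_weight k a b (k.+1 + f i))
   (fun i j => (falling_poly a j).[(k.+1 + f i)%:R ^+ 2])) -mulrA; congr (_ * _).
rewrite !(det_falling_poly _ (fun i => (k.+1 + f i)%:R ^+ 2)) mulrACA -!expr2.
have -> : (\prod_(i < n) (-1) ^+ i) ^+ 2 = 1 :> rat.
  by rewrite -prodrXl big1 // => i _; rewrite sqrr_sign.
by rewrite mul1r.
Qed.

End ClosedForm.

(** * Product formula *)

(** The Barnes value [G(n + 1)]. Up to powers of [(k + 1)!], which cancel, every product below is a
    quotient of such values, so the final comparison is pure cancellation. *)
Definition superfact (n : nat) : rat := \prod_(i < n) i`!%:R.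

Lemma superfact_neq0 n : superfact n != 0.
Proof. by apply/prodf_neq0 => i _; apply: natr_fact_neq0. Qed.

Lemma superfactS n : superfact n.+1 = superfact n * n`!%:R.
Proof. by rewrite /superfact big_ord_recr. Qed.

Lemma superfact0 : superfact 0 = 1.
Proof. by rewrite /superfact big_ord0. Qed.

Lemma prod_fact_shift m n :
  \prod_(i < n) (m + i)`!%:R = superfact (m + n) / superfact m.
Proof.
elim: n => [|n IH]; first by rewrite big_ord0 addn0 divff ?superfact_neq0.
by rewrite big_ord_recr /= IH addnS superfactS mulrAC.
Qed.

Lemma prod_fact_reflect m n : (n <= m.+1)%N ->
  \prod_(i < n) (m - i)`!%:R = superfact m.+1 / superfact (m.+1 - n).
Proof.
move=> le; rewrite (reindex_inj rev_ord_inj) /=.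
rewrite (eq_bigr (fun i : 'I_n => ((m.+1 - n) + i)`!%:R)) => [|i _]; last first.
  by congr (_`!%:R); have := ltn_ord i; lia.
by rewrite prod_fact_shift subnK.
Qed.

Lemma pochhammer_natE m k : pochhammer m.+1%:R k = (m + k)`!%:R / m`!%:R.
Proof.
by rewrite -fact_prod_rising mulrAC divff ?natr_fact_neq0 // mul1r.
Qed.

Lemma prod_pochhammer m k q :
  \prod_(1 <= i < q.+1) pochhammer (m%:R + i%:R) k =
  superfact (m + k + q) / superfact (m + k) / (superfact (m + q) / superfact m).
Proof.
rewrite big_add1 /= big_mkord.
rewrite (eq_bigr (fun i : 'I_q => (m + k + i)`!%:R * ((m + i)`!%:R)^-1)) => [|i _]; last first.
  by rewrite -natrD addnS pochhammer_natE addnAC.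
by rewrite big_split /= prodfV !prod_fact_shift.
Qed.

(** MacMahon's box product: the innermost product telescopes, the middle one then gives quotients of
    factorials, and the outer one collects them. *)
Lemma P_superfact x y z : P x y z =
  superfact x * superfact y * superfact z * superfact (x + y + z) /
  (superfact (x + y) * superfact (x + z) * superfact (y + z)).
Proof.
have nz := superfact_neq0; have nf := natr_fact_neq0.
have row i j : \prod_(1 <= k < z.+1) ((i.+1 + j.+1 + k - 1)%N%:R / (i.+1 + j.+1 + k - 2)%N%:R : rat)
    = (i + j + z).+1%:R / (i + j).+1%:R.
  elim: z => [|t IH]; first by rewrite big_geq // addn0 divff // pnatr_eq0.
  rewrite big_nat_recr //= IH.
  rewrite (_ : i.+1 + j.+1 + t.+1 - 1 = (i + j + t.+1).+1)%N; last lia.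
  rewrite (_ : i.+1 + j.+1 + t.+1 - 2 = (i + j + t).+1)%N; last lia.
  by rewrite mulrC mulrA divfK // pnatr_eq0.
have plane i : \prod_(1 <= j < y.+1) \prod_(1 <= k < z.+1)
     ((i.+1 + j + k - 1)%N%:R / (i.+1 + j + k - 2)%N%:R : rat)
    = (i + z + y)`!%:R / (i + z)`!%:R * (i`!%:R / (i + y)`!%:R).
  elim: y => [|t IH]; first by rewrite big_geq // !addn0 !divff ?mulr1 // nf.
  rewrite big_nat_recr //= IH row !addnS !natr_factS.
  have n1 : (i + t).+1%:R != 0 :> rat by rewrite pnatr_eq0.
  have := nf (i + z)%N; have := nf (i + t)%N; rewrite [(i + t + z)%N]addnAC.
  move: n1; move: (i + t).+1%:R (i + z + t).+1%:R (i + z)`! (i + t)`! (i + z + t)`! i`! => u v r s w x0 h1 h2 h3.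
  by field; rewrite h1 h2 h3.
rewrite /P big_add1 /= big_mkord (eq_bigr _ (fun i _ => plane (nat_of_ord i))).
rewrite !big_split /= !prodfV.
rewrite (eq_bigr (fun i : 'I_x => (z + y + i)`!%:R)) => [|i _]; last by congr (_`!%:R); lia.
rewrite [X in _ / X](eq_bigr (fun i : 'I_x => (z + i)`!%:R)) => [|i _]; last by rewrite addnC.
rewrite [X in _ * (_ / X)](eq_bigr (fun i : 'I_x => (y + i)`!%:R)) => [|i _]; last by rewrite addnC.
rewrite !prod_fact_shift -/(superfact x).
rewrite (_ : z + y + x = x + y + z)%N; last lia.
rewrite [(z + y)%N]addnC [(z + x)%N]addnC [(y + x)%N]addnC.
by field; rewrite !nz.
Qed.

(** Separates a factor in [a], a factor in [b] and one in [a + b]; for shifted arguments [a - i] and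
    [b - j] the last depends on [i + j] alone, as [norm_det_fact_ratio] requires. *)
Lemma racah_sum_fact M k a b : (k < a)%N -> (k < b)%N -> (minn a b < M)%N ->
  racah_sum M k a b =
  (k.+1`!%:R / ((a - k.+1)`!%:R * a.-1`!%:R)) *
  (1 / ((b - k.+1)`!%:R * b.-1`!%:R)) * ((a + b - k.+2)`!%:R / (a + b)`!%:R).
Proof.
move=> ka kb hM; have nz := natr_fact_neq0.
have eb : (b = k.+1 + (b - k.+1))%N by lia.
rewrite {1}eb racah_sumE; [|lia|by rewrite -eb].
rewrite -eb (_ : k + (b - k.+1) = b.-1)%N; last lia.
have e1 : ((a.-1 + (b - k.+1))`! = 'C(a.-1 + (b - k.+1), b - k.+1) * ((b - k.+1)`! * a.-1`!))%N.
  by rewrite -(@bin_fact _ (b - k.+1)) ?addnK // leq_addl.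
have e2 : (a`! = a ^_ k.+1 * (a - k.+1)`!)%N by rewrite ffact_fact.
have f1 : (a ^_ k.+1)%:R != 0 :> rat by rewrite pnatr_eq0 -lt0n ffact_gt0.
rewrite (_ : a + b - k.+2 = a.-1 + (b - k.+1))%N; last lia.
have := nz (b - k.+1)%N; have := nz (a - k.+1)%N; have := nz a.-1; have := nz b.-1; have := nz (a + b)%N.
move: f1 e1 e2.
move: (a ^_ k.+1)%N 'C(_, _) (a.-1 + (b - k.+1))`! a`! (b - k.+1)`! (a - k.+1)`! a.-1`! b.-1`! (a + b)`! k.+1`!.
move=> u1 u2 u3 u4 u5 u6 u7 u8 u9 u10 f1 -> -> h1 h2 h3 h4 h5; rewrite !natrM.
by field; rewrite f1 h1 h2 h3 h4 h5.
Qed.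

Lemma norm_det_racah_sum n k p q :
  let a := (p + n + k)%N in let b := (q + n + k)%N in
  `|\det (\matrix_(i < n, j < n) racah_sum (minn a b).+1 k (a - i) (b - j))| =
  \prod_(i < n) (k.+1`!%:R / ((a - i - k.+1)`!%:R * (a - i).-1`!%:R)) *
  \prod_(i < n) (1 / ((b - i - k.+1)`!%:R * (b - i).-1`!%:R)) *
  \prod_(i < n) ((a + b - k.+2 - i - n.-1)`!%:R / (a + b - i)`!%:R * i`!%:R *
     ((k.+1 + (n.-1 - i))`!%:R / k.+1`!%:R)).
Proof.
(* For [n = 0] the subtraction [a + b - k.+2] may truncate, so the empty determinant is treated
   apart. *)
move=> a b; have [n0|n_gt0] := posnP n.
  by rewrite {}n0 in a b *; rewrite det_mx00 normr1 !big_ord0 !mulr1.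
pose r (i : 'I_n) : rat := k.+1`!%:R / ((a - i - k.+1)`!%:R * (a - i).-1`!%:R).
pose c (i : 'I_n) : rat := 1 / ((b - i - k.+1)`!%:R * (b - i).-1`!%:R).
have -> : \matrix_(i < n, j < n) racah_sum (minn a b).+1 k (a - i) (b - j) =
  \matrix_(i, j) (r i * (c j * ((a + b - k.+2 - i - j)`!%:R /
      (a + b - k.+2 + k.+2 - i - j)`!%:R))).
  apply/matrixP => i j; rewrite !mxE; have hi := ltn_ord i; have hj := ltn_ord j.
  rewrite racah_sum_fact; try (rewrite /a /b; lia).
  rewrite (_ : a - i + (b - j) - k.+2 = a + b - k.+2 - i - j)%N; last by rewrite /a /b; lia.
  rewrite (_ : a - i + (b - j) = a + b - k.+2 + k.+2 - i - j)%N; last by rewrite /a /b; lia.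
  by rewrite -[LHS]mulrA.
rewrite (det_rows_scale r) (det_cols_scale c) !normrM mulrA.
rewrite norm_det_fact_ratio; last by rewrite /a /b; lia.
rewrite (_ : a + b - k.+2 + k.+2 = a + b)%N; last by rewrite /a /b; lia.
by congr (_ * _ * _); rewrite ger0_norm // prodr_ge0 // => i _; rewrite divr_ge0 // mulr_ge0.
Qed.

Lemma closed_form n k p q (a := (p + n + k)%N) (b := (q + n + k)%N) :
  (0 < p + q + k)%N ->
  (\prod_(j < n + (n + k.+1)) (a + b - j)`!%:R) *
  (\prod_(t < k.+1) (t`!%:R * end_weight (a + b) (a + t))) *
  `|\det (\matrix_(i < n, j < n) racah_sum (minn a b).+1 k (a - i) (b - j))| =
  P (n + k.+1) q k *
  (\prod_(1 <= i < n.+1) (pochhammer (p%:R + i%:R) k / pochhammer i%:R k)) *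
  (\prod_(1 <= i < q.+1)
     ((pochhammer ((p + k)%:R + i%:R) n / pochhammer (k%:R + i%:R) n) *
      (pochhammer ((p + k)%:R + i%:R) (n + k.+1) / pochhammer (k%:R + i%:R) (n + k.+1)))).
Proof.
move=> pos; have nz := superfact_neq0; have nf := natr_fact_neq0.
rewrite norm_det_racah_sum -/a -/b.
rewrite prod_fact_reflect; last by rewrite /a /b; lia.
rewrite (_ : (a + b).+1 - (n + (n + k.+1)) = p + q + k)%N; last by rewrite /a /b; lia.
have -> : \prod_(t < k.+1) (t`!%:R * end_weight (a + b) (a + t)) =
   superfact k.+1 * (superfact a / superfact (a + k.+1)) * (superfact (q + n) / superfact b.+1).
  rewrite (eq_bigr (fun t : 'I_k.+1 => t`!%:R * ((a + t)`!%:R^-1 * (b - t)`!%:R^-1))) => [|t _].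
    rewrite !big_split /= !prodfV prod_fact_shift prod_fact_reflect; last by rewrite /b; lia.
    rewrite (_ : b.+1 - k.+1 = q + n)%N; last by rewrite /b; lia.
    by rewrite !invf_div mulrA.
  have ht := ltn_ord t; rewrite /end_weight ifT; last by rewrite /b; lia.
  rewrite natrM invfM; congr (_ * (_ * _)); congr (_`!%:R^-1); rewrite /b; lia.
have half m (c := (m + n + k)%N) :
    \prod_(i < n) ((c - i - k.+1)`!%:R * (c - i).-1`!%:R) =
    superfact (m + n) / superfact m * (superfact (m + n + k) / superfact (m + k)) :> rat.
  rewrite big_split /=; congr (_ * _).
    case: (n) @c => [|n'] c; first by rewrite big_ord0 addn0 divff.
    rewrite (eq_bigr (fun i : 'I_n'.+1 => (m + n' - i)`!%:R)) => [|i _]; last first.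
      by congr (_`!%:R); have := ltn_ord i; rewrite /c; lia.
    rewrite prod_fact_reflect; last lia.
    by rewrite -addnS addnK.
  case: (n) @c => [|n'] c; first by rewrite big_ord0 addn0 divff.
  rewrite (eq_bigr (fun i : 'I_n'.+1 => (m + n' + k - i)`!%:R)) => [|i _]; last first.
    by congr (_`!%:R); have := ltn_ord i; rewrite /c; lia.
  rewrite prod_fact_reflect; last lia.
  have e1 : ((m + n' + k).+1 - n'.+1 = m + k)%N by lia.
  have e2 : ((m + n' + k).+1 = m + n'.+1 + k)%N by lia.
  by rewrite e1 e2.
have -> : \prod_(i < n) (k.+1`!%:R / ((a - i - k.+1)`!%:R * (a - i).-1`!%:R)) =
   k.+1`!%:R ^+ n / (superfact (p + n) / superfact p * (superfact a / superfact (p + k))).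
  by rewrite big_split /= prodr_const card_ord prodfV half.
have -> : \prod_(i < n) (1 / ((b - i - k.+1)`!%:R * (b - i).-1`!%:R)) =
   (superfact (q + n) / superfact q * (superfact b / superfact (q + k)))^-1.
  by rewrite -half -prodfV; apply: eq_bigr => i _; rewrite mul1r.
have -> : \prod_(i < n) ((a + b - k.+2 - i - n.-1)`!%:R / (a + b - i)`!%:R * i`!%:R *
     ((k.+1 + (n.-1 - i))`!%:R / k.+1`!%:R)) =
  superfact (p + q + k + n) / superfact (p + q + k) /
  (superfact (a + b).+1 / superfact (p + q + n + k + k.+1)) * superfact n *
  (superfact (k.+1 + n) / superfact k.+1 / k.+1`!%:R ^+ n).
  rewrite !big_split /= !prodfV prodr_const card_ord -/(superfact n).
  congr (_ / _ * _ * (_ / _)).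
  - rewrite (reindex_inj rev_ord_inj) /= -prod_fact_shift; apply: eq_bigr => i _.
    by congr (_`!%:R); have := ltn_ord i; rewrite /a /b; lia.
  - rewrite prod_fact_reflect; last by rewrite /a /b; lia.
    by congr (_ / _); congr superfact; rewrite /a /b; lia.
  - rewrite (reindex_inj rev_ord_inj) /= -prod_fact_shift; apply: eq_bigr => i _.
    by congr (_`!%:R); have := ltn_ord i; lia.
have -> : \prod_(1 <= i < n.+1) (pochhammer (p%:R + i%:R) k / pochhammer i%:R k) =
  superfact (p + k + n) / superfact (p + k) / (superfact (p + n) / superfact p) /
  (superfact (k + n) / superfact k / superfact n).
  rewrite big_split /= prodfV prod_pochhammer; congr (_ / _).
  have := prod_pochhammer 0 k n; rewrite !add0n superfact0 divr1 => <-.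
  by apply: eq_bigr => i _; rewrite add0r.
rewrite !big_split /= !prodfV !prod_pochhammer P_superfact.
rewrite /a /b.
(* Equal arguments of [superfact] are brought to one syntactic form, so that [field] identifies
   them. *)
rewrite (_ : n + k.+1 + k = k + (n + k.+1))%N; last lia.
rewrite (_ : k.+1 + n = n + k.+1)%N; last lia.
rewrite (_ : p + n + k + k.+1 = p + k + (n + k.+1))%N; last lia.
rewrite (_ : p + q + n + k + k.+1 = p + k + (n + k.+1) + q)%N; last lia.
rewrite (_ : p + n + k = p + k + n)%N; last lia.
rewrite (_ : (q + n + k).+1 = n + k.+1 + q)%N; last lia.
rewrite (_ : q + n + k = k + n + q)%N; last lia.
rewrite (_ : p + q + k + n = p + k + n + q)%N; last lia.
rewrite (_ : p + q + k = p + k + q)%N; last lia.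
rewrite (_ : n + k.+1 + q + k = k + (n + k.+1) + q)%N; last lia.
rewrite (_ : q + k = k + q)%N; last lia.
have hk : k.+1`!%:R ^+ n != 0 :> rat by rewrite expf_neq0.
by field; rewrite !nz hk.
Qed.

Lemma M_odot_set0 m n : M_odot (set0 : {set cell m n}) = 1%N.
Proof.
rewrite /M_odot (_ : [set T | _] = [set set0]) ?cards1 //.
apply/setP => T; rewrite !inE /is_tiling partition_set0.
have [->|//] := eqVneq; rewrite /centrally_symmetric imset0 eqxx andbT.
by apply/forall_inP => L; rewrite inE.
Qed.

Lemma region_set0 n : region (n + (n + 1)) n n 0 n.*2.+1 n.*2.+1 = set0.
Proof.
apply/setP => -[[u v] up]; rewrite !inE; apply/negbTE.
by case: up; rewrite /up_in /down_in; lia.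
Qed.

Lemma M_odot_closed n k p q :
  (M_odot (B' (p + p + k) (n + (n + k.+1)) (q + q + k) k))%:R =
  P (n + k.+1) q k *
  (\prod_(1 <= i < n.+1) (pochhammer (p%:R + i%:R) k / pochhammer i%:R k)) *
  (\prod_(1 <= i < q.+1)
     ((pochhammer ((p + k)%:R + i%:R) n / pochhammer (k%:R + i%:R) n) *
      (pochhammer ((p + k)%:R + i%:R) (n + k.+1) / pochhammer (k%:R + i%:R) (n + k.+1))))
  :> rat.
Proof.
rewrite (@M_odot_B' _ (p + n + k) (q + n + k)); [|lia|lia].
(* If [p = q = k = 0] then [y = a + b + 1], beyond the bound [y <= a + b] of the counting. The
   hexagon is then degenerate, the region is empty, and its only tiling is the empty one. *)
have [|pos] := posnP (p + q + k).
  move=> pqk0; have -> : p = 0%N by lia.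
  have -> : q = 0%N by lia.
  have -> : k = 0%N by lia.
  rewrite !addn0 !add0n region_set0 M_odot_set0 [\prod_(1 <= i < 1) _]big_geq // mulr1.
  rewrite /P big1 ?mul1r => [|i _]; last by rewrite big_geq.
  by rewrite big1 // => i _; rewrite /pochhammer !big_ord0 divr1.
(* The moment determinant is evaluated up to sign only; a count is nonnegative, so absolute values
   lose nothing. *)
rewrite -closed_form // -[LHS]ger0_norm // M_odot_det; [|lia|lia|lia].
rewrite normrM; congr (_ * _); rewrite ger0_norm // mulr_ge0 ?prodr_ge0 // => t _.
by rewrite mulr_ge0 ?end_weight_ge0.
Qed.

Theorem theorem5 (x y z k : nat)
    (hkx : (k <= x)%N) (hky : (k <= y)%N) (hkz : (k <= z)%N)
    (hx : odd x = ~~ odd y) (hz : odd z = ~~ odd y) (hk : odd k = ~~ odd y) :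
  (M_odot (B' x y z k))%:R =
    P (y + k + 1)./2 (z - k)./2 k
    * (\prod_(1 <= i < ((y - k - 1)./2).+1)
         (pochhammer ((x%:R - k%:R) / 2%:R + i%:R) k / pochhammer i%:R k))
    * (\prod_(1 <= i < ((z - k)./2).+1)
         ((pochhammer ((x%:R + k%:R) / 2%:R + i%:R) (y - k - 1)./2
             / pochhammer (k%:R + i%:R) (y - k - 1)./2)
          * (pochhammer ((x%:R + k%:R) / 2%:R + i%:R) (y + k + 1)./2
             / pochhammer (k%:R + i%:R) (y + k + 1)./2)))
  :> rat.
Proof.
(* By parity [x - k], [z - k] and [y - k - 1] are even, and [k < y], so these halvings and
   subtractions are exact. *)
pose n := (y - k - 1)./2; pose p := (x - k)./2; pose q := (z - k)./2.
have ex : x = (p + p + k)%N by rewrite /p; lia.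
have ez : z = (q + q + k)%N by rewrite /q; lia.
have ey : y = (n + (n + k.+1))%N by rewrite /n; lia.
have hy : ((y + k + 1)./2 = n + k.+1)%N by lia.
rewrite -/n -/q hy [in LHS]ex [in LHS]ey [in LHS]ez M_odot_closed.
have -> : (x%:R - k%:R) / 2%:R = p%:R :> rat by rewrite ex !natrD; field.
have -> : (x%:R + k%:R) / 2%:R = (p + k)%:R :> rat by rewrite ex !natrD; field.
by [].
Qed.
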